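(* Let $\mathbb{K}$ be a field of characteristic zero, $S=\mathbb{K}[x_1,x_2,x_3,x_4]$ with the standard grading, and $I\subset S$ a homogeneous ideal containing no nonzero linear form such that $A=S/I$ is an Artinian Gorenstein algebra with $H$-vector $(1,4,4,4,4,1)$. Then the nonzero graded Betti numbers $b_{i,j}$ of $A$ over $S$ are exactly $$b_{0,0}=1,\quad b_{1,2}=6,\quad b_{2,3}=8,\quad b_{3,4}=3,\quad b_{1,5}=3,\quad b_{2,6}=8,\quad b_{3,7}=6,\quad b_{4,9}=1,$$ and all other $b_{i,j}$ are zero.
   Context: The $H$-vector of an Artinian graded algebra $A=S/I$ is $(1,h_1,\dots,h_s)$, where $h_i=\dim_{\mathbb{K}}A_i$ and $s$ is the socle degree, i.e. the largest $i$ with $A_i\neq 0$. The graded Betti numbers $b_{i,j}$ of $A$ are defined by the minimal graded free resolution of $A$ over $S$, whose $i$-th module is $F_i\simeq\bigoplus_j S(-j)^{b_{i,j}}$; equivalently $b_{i,j}=\dim_{\mathbb{K}}\operatorname{Tor}_i^S(A,\mathbb{K})_j$. *)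

(* Defs.v *)
From HB Require Import structures.
From mathcomp Require Export all_boot all_order all_algebra.
From mathcomp.multinomials Require Export mpoly.

Set Implicit Arguments.
Unset Strict Implicit.
Unset Printing Implicit Defensive.

Import GRing.Theory.
Local Open Scope ring_scope.

(* The quotient S/I is not built as a type: I is an arbitrary Prop-valued
   subset of S = {mpoly K[n]}, and statements about S/I are statements about
   representatives modulo I. *)

Definition is_ideal (n : nat) (K : fieldType) (I : {mpoly K[n]} -> Prop) : Prop :=
  [/\ I 0,
      (forall p q, I p -> I q -> I (p + q)) &
      (forall a p, I p -> I (a * p))].

Definition is_homog_ideal (n : nat) (K : fieldType)
    (I : {mpoly K[n]} -> Prop) : Prop :=
  is_ideal I /\ forall p (d : nat), I p -> I (pihomog mdeg d p).

(* The image of the subspace V in S/I has a K-basis with r elements. *)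
Definition has_dim_mod (n : nat) (K : fieldType)
    (V I : {mpoly K[n]} -> Prop) (r : nat) : Prop :=
  exists e : 'I_r -> {mpoly K[n]},
    [/\ (forall k, V (e k)),
        (forall c : 'I_r -> K, I (\sum_k c k *: e k) -> forall k, c k = 0) &
        (forall p, V p -> exists c : 'I_r -> K, I (p - \sum_k c k *: e k))].

(* The Hilbert function of S/I is h followed by zeros; the last entry of h is
   required to be nonzero so that (size h).-1 is the largest degree in which
   S/I is nonzero. *)
Definition has_H_vector (n : nat) (K : fieldType)
    (I : {mpoly K[n]} -> Prop) (h : seq nat) : Prop :=
  last 0%N h != 0%N /\
  forall d : nat, has_dim_mod (fun p => p \is d.-homog) I (nth 0%N h d).

(* Descending chain condition; ideals of S/I are the ideals of S containing I. *)
Definition quotient_artinian (n : nat) (K : fieldType)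
    (I : {mpoly K[n]} -> Prop) : Prop :=
  forall J : nat -> {mpoly K[n]} -> Prop,
    (forall k, is_ideal (J k)) ->
    (forall k p, I p -> J k p) ->
    (forall k p, J k.+1 p -> J k p) ->
    exists N, forall k, (N <= k)%N -> forall p, J N p -> J k p.

(* Representatives of the socle (0 : (x_1, ..., x_n)) of S/I. *)
Definition in_socle (n : nat) (K : fieldType)
    (I : {mpoly K[n]} -> Prop) (p : {mpoly K[n]}) : Prop :=
  forall k : 'I_n, I ('X_k * p).

Definition quotient_artinian_gorenstein (n : nat) (K : fieldType)
    (I : {mpoly K[n]} -> Prop) : Prop :=
  quotient_artinian I /\ has_dim_mod (in_socle I) I 1.

(* Homogeneous of integer degree d; for d < 0 this forces p = 0. *)
Definition zhomog (n : nat) (K : fieldType) (d : int) (p : {mpoly K[n]}) : Prop :=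
  forall m, m \in msupp p -> (mdeg m)%:Z = d.

(* A sequence ... -> F_1 -> F_0 -> S/I with
   F_i = \bigoplus_(k < gf_rank i) S(- gf_deg i k).
   Elements of F_i are row vectors and maps act by right multiplication;
   gf_aug lists representatives in S of the images in S/I of the basis of F_0. *)
Record gfree_seq (n : nat) (K : fieldType) := GFreeSeq {
  gf_rank : nat -> nat;
  gf_deg : forall i : nat, 'I_(gf_rank i) -> int;
  gf_aug : 'cV[{mpoly K[n]}]_(gf_rank 0);
  gf_diff : forall i : nat, 'M[{mpoly K[n]}]_(gf_rank i.+1, gf_rank i)
}.

Definition gf_graded (n : nat) (K : fieldType) (F : gfree_seq n K) : Prop :=
  (forall k, zhomog (gf_deg k) (gf_aug F k 0)) /\
  (forall i a b, zhomog (gf_deg a - gf_deg b) (gf_diff F i a b)).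

Definition gf_resolves (n : nat) (K : fieldType)
    (I : {mpoly K[n]} -> Prop) (F : gfree_seq n K) : Prop :=
  [/\ (forall p, exists v : 'rV_(gf_rank F 0), I (p - (v *m gf_aug F) 0 0)),
      (forall v : 'rV_(gf_rank F 0),
         I ((v *m gf_aug F) 0 0) <-> exists w, v = w *m gf_diff F 0) &
      (forall i (v : 'rV_(gf_rank F i.+1)),
         v *m gf_diff F i = 0 <-> exists w, v = w *m gf_diff F i.+1)].

(* The image of F_(i+1) lies in (x_1, ..., x_n) F_i: every matrix entry has
   zero constant term. *)
Definition gf_minimal (n : nat) (K : fieldType) (F : gfree_seq n K) : Prop :=
  forall i a b, (gf_diff F i a b)@_0%MM = 0.

Definition minimal_graded_free_resolution (n : nat) (K : fieldType)
    (I : {mpoly K[n]} -> Prop) (F : gfree_seq n K) : Prop :=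
  [/\ gf_graded F, gf_resolves I F & gf_minimal F].

Definition gf_betti (n : nat) (K : fieldType) (F : gfree_seq n K)
    (i : nat) (j : int) : nat :=
  #|[set k : 'I_(gf_rank F i) | gf_deg k == j]|.

(* b is the family of graded Betti numbers of S/I: a minimal graded free
   resolution exists, and every such resolution has
   F_i = \bigoplus_j S(-j)^(b i j). *)
Definition has_graded_betti (n : nat) (K : fieldType)
    (I : {mpoly K[n]} -> Prop) (b : nat -> int -> nat) : Prop :=
  (exists F, minimal_graded_free_resolution I F) /\
  (forall F, minimal_graded_free_resolution I F ->
     forall i j, gf_betti F i j = b i j).

(* The family whose nonzero values are the entries (i, j, b_ij) of t. *)
Definition betti_table (t : seq (nat * int * nat)) (i : nat) (j : int) : nat :=
  (\sum_(e <- t | e.1 == (i, j)) e.2)%N.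

(* Main.v *)
Require Import Defs.
From mathcomp Require Import ring zify.
From Stdlib Require Import Classical ClassicalEpsilon.
Import GRing.Theory.
Local Open Scope ring_scope.
Set Implicit Arguments.
Unset Strict Implicit.
Unset Printing Implicit Defensive.

(** If A is a graded quotient of S of finite length, with commuting
    multiplication matrices M_1, ..., M_n, then the Koszul complex of
    x_1 - M_1, ..., x_n - M_n on S tensor A is a graded free resolution G of A.
    Cancelling unit entries of its differential yields a minimal resolution, and
    since G tensor K is the Koszul complex of A, comparing a minimal resolution F
    with G gives b_(i,j)(F) = dim H_i(x; A)_j.

    For the H-vector (1,4,4,4,4,1) some linear form l is injective from A_1 to
    A_2: annihilators in A_1 of five members x + t y of a pencil are linearly
    dependent, which forces y^4 to kill ann(x + t y) for all but at most four t.
    For x outside the exceptional sets of enough y, all of S_4 kills ann(x), and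
    then ann(x) = 0 because the socle of A is A_5.  It follows that l is bijective
    A_1 -> A_2 -> A_3 -> A_4, and as l is null-homotopic on the Koszul complex,
    H_i(x; A)_(i+a) vanishes for a = 2, 3.  It vanishes for a = 0, i > 0 because I
    contains no linear form, and for a = 5, i < 4 by the duality of A_1 and A_4.
    Each strand j then has at most one nonzero homology group, whose dimension is
    given by the Euler characteristic. *)

(** * Homogeneous parts and homogeneous ideals *)

(** Only finitely many y are used: the sums of at most four variables, whose fourth powers span S_4
    by polarization. A common x outside their exceptional sets is found by counting on a finite
    integer grid, which characteristic zero embeds in K; the same hypothesis lets the homotopy
    behind the exactness of G divide by degrees. Injectivity of l on A_1 does not pass to higher
    degrees by itself. Surjectivity does, because A is generated in degree one, and the equality of
    the dimensions of A_1, ..., A_4 converts one into the other in each degree. After the vanishing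
    for a = 0, 2, 3, 5 the values a = 1 and a = 4 remain, and two strands still contain both of
    them: strand 4 at (i, a) = (3, 1), (0, 4) and strand 5 at (4, 1), (1, 4). The two ends of the
    complex settle this: H_0 vanishes in positive degree since A is generated by 1, and H_4 is the
    socle, which lives in a = 5 only. *)

Section ZHomog.
Variables (n : nat) (K : fieldType).
Implicit Types (p q : {mpoly K[n]}) (d e : int).

Lemma zhomogP d p : zhomog d p <-> forall m, (mdeg m)%:Z != d -> p@_m = 0.
Proof.
split=> h m; last first.
  by move=> mp; apply/eqP; apply: contraTT mp => /h; rewrite mcoeff_msupp => ->; rewrite eqxx.
move=> nd; apply/eqP; rewrite mcoeff_eq0; apply: contra nd => /h ->; exact: eqxx.
Qed.

Lemma zhomog0 d : zhomog d (0 : {mpoly K[n]}).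
Proof. by move=> m; rewrite msupp0. Qed.

Lemma zhomogD d p q : zhomog d p -> zhomog d q -> zhomog d (p + q).
Proof. by move=> /zhomogP hp /zhomogP hq; apply/zhomogP=> m nd; rewrite mcoeffD hp // hq // addr0. Qed.

Lemma zhomogN d p : zhomog d p -> zhomog d (- p).
Proof. by move=> /zhomogP hp; apply/zhomogP=> m nd; rewrite mcoeffN hp // oppr0. Qed.

Lemma zhomogB d p q : zhomog d p -> zhomog d q -> zhomog d (p - q).
Proof. by move=> hp /zhomogN; apply: zhomogD. Qed.

Lemma zhomogZ d c p : zhomog d p -> zhomog d (c *: p).
Proof. by move=> /zhomogP hp; apply/zhomogP=> m nd; rewrite mcoeffZ hp // mulr0. Qed.

Lemma zhomog_sum (T : Type) (r : seq T) (P : pred T) (G : T -> {mpoly K[n]}) d :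
  (forall t, P t -> zhomog d (G t)) -> zhomog d (\sum_(t <- r | P t) G t).
Proof. by move=> h; elim/big_ind: _ => //; [exact: zhomog0 | exact: zhomogD]. Qed.

Lemma zhomogM d e p q : zhomog d p -> zhomog e q -> zhomog (d + e) (p * q).
Proof.
move=> /zhomogP hp /zhomogP hq; apply/zhomogP=> m nd; rewrite mcoeffM big1 // => -[k l] /= /eqP /(congr1 mdeg).
rewrite mdegD => mE; have [kos_diff|/hp->] := eqVneq (mdeg (val k))%:Z d; last by rewrite mul0r.
have [ld|/hq->] := eqVneq (mdeg (val l))%:Z e; last by rewrite mulr0.
have mde : (mdeg m)%:Z = d + e by rewrite mE PoszD kos_diff ld.
by rewrite mde eqxx in nd.
Qed.

Lemma zhomogC (c : K) : zhomog 0 (c%:MP_[n]).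
Proof. by apply/zhomogP=> m; rewrite mcoeffC; case: (m =P 0%MM) => [->|_ _]; rewrite ?mdeg0 ?mulr0. Qed.

Lemma zhomog_dhomog (d : nat) p : zhomog d%:Z p <-> p \is d.-homog.
Proof.
split=> [h|/dhomogP h m /h /= -> //].
by apply/dhomogP=> m /h [].
Qed.

Lemma zhomog_const p : zhomog 0 p -> p = (p@_0)%:MP.
Proof.
move/zhomogP=> h; apply/mpolyP=> m; rewrite mcoeffC.
have [->|m0] := eqVneq m 0%MM; first by rewrite mulr1.
by rewrite mulr0 h //; rewrite -mdeg_eq0 in m0.
Qed.

Lemma zhomog_coef0 d p : zhomog d p -> p@_0%MM != 0 -> d = 0.
Proof. by move=> h; rewrite -mcoeff_msupp => /h; rewrite mdeg0. Qed.

(** Total on integers, so that a matrix entry of degree [dA a - dB b] is projected without asking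
    whether this difference is negative. *)
Definition zpart d p : {mpoly K[n]} := if d is Posz k then pihomog mdeg k p else 0.

Lemma mcoeff_pihomog (k : nat) p m :
  (pihomog mdeg k p)@_m = if mdeg m == k then p@_m else 0.
Proof.
rewrite pihomogE raddf_sum /=.
under eq_bigr do rewrite mcoeffZ mcoeffX.
have [mk|mk] := eqVneq (mdeg m) k; last first.
  rewrite big1 // => m' /eqP m'k; have [mm|] := eqVneq m' m; last by rewrite mulr0.
  by rewrite -mm m'k eqxx in mk.
have [mp|mp] := boolP (m \in msupp p).
  rewrite -big_filter (bigD1_seq m) ?filter_uniq ?msupp_uniq //= ?eqxx ?mulr1; last first.
    by rewrite mem_filter mk eqxx.
  by rewrite big1 ?addr0 // => m' /negbTE ->; rewrite mulr0.
rewrite (memN_msupp_eq0 mp) big_seq_cond big1 // => m' /andP[m'p _].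
by have [mm|] := eqVneq m' m; [rewrite -mm m'p in mp | rewrite mulr0].
Qed.

Lemma mcoeff_zpart d p m : (zpart d p)@_m = if (mdeg m)%:Z == d then p@_m else 0.
Proof. by case: d => k /=; [rewrite mcoeff_pihomog | rewrite mcoeff0]. Qed.

Lemma zpart_homog d p : zhomog d (zpart d p).
Proof. by apply/zhomogP=> m nd; rewrite mcoeff_zpart (negbTE nd). Qed.

Lemma zpart_id d p : zhomog d p -> zpart d p = p.
Proof.
move/zhomogP=> h; apply/mpolyP=> m; rewrite mcoeff_zpart; case: ifPn => // /h -> //.
Qed.

Lemma zpartD d p q : zpart d (p + q) = zpart d p + zpart d q.
Proof. by apply/mpolyP=> m; rewrite mcoeffD !mcoeff_zpart mcoeffD; case: ifP; rewrite ?addr0. Qed.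

Lemma zpartN d p : zpart d (- p) = - zpart d p.
Proof. by apply/mpolyP=> m; rewrite mcoeffN !mcoeff_zpart mcoeffN; case: ifP; rewrite ?oppr0. Qed.

Lemma zpart0 d : zpart d 0 = 0.
Proof. by apply/mpolyP=> m; rewrite mcoeff_zpart mcoeff0; case: ifP. Qed.

Lemma zpart_sum (T : Type) (r : seq T) (P : pred T) (G : T -> {mpoly K[n]}) d :
  zpart d (\sum_(t <- r | P t) G t) = \sum_(t <- r | P t) zpart d (G t).
Proof. by apply: (big_morph (zpart d)); [exact: zpartD | exact: zpart0]. Qed.

Lemma zpartMr d e p q : zhomog e q -> zpart (d + e) (p * q) = zpart d p * q.
Proof.
move=> /zhomogP hq; apply/mpolyP=> m; rewrite mcoeff_zpart !mcoeffM.
case: ifPn => md.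
  apply: eq_bigr => -[k l] /= /eqP /(congr1 mdeg); rewrite mdegD mcoeff_zpart => mE; case: ifPn => // kos_diff.
  rewrite hq ?mulr0 //; apply: contra kos_diff => /eqP le; move/eqP: md => md.
  have := congr1 Posz mE; rewrite PoszD le => mde.
  by apply/eqP/(addIr e); rewrite -mde.
rewrite big1 // => -[k l] /= /eqP /(congr1 mdeg); rewrite mdegD mcoeff_zpart => mE; case: ifPn => [/eqP kos_diff|_]; last by rewrite mul0r.
rewrite hq ?mulr0 //; apply: contra md => /eqP le.
by rewrite mE PoszD kos_diff le.
Qed.


End ZHomog.

Section HomogIdeal.
Variables (n : nat) (K : fieldType) (I : {mpoly K[n]} -> Prop).
Hypothesis homI : is_homog_ideal I.
Implicit Types (p q : {mpoly K[n]}).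

Lemma ideal0 : I 0. Proof. by case: homI => -[]. Qed.

Lemma idealD p q : I p -> I q -> I (p + q).
Proof. by case: homI => -[] _ h _ _; apply: h. Qed.

Lemma idealM a p : I p -> I (a * p).
Proof. by case: homI => -[] _ _ h _; apply: h. Qed.

Lemma idealN p : I p -> I (- p).
Proof. by move=> /(idealM (-1)); rewrite mulN1r. Qed.

Lemma idealB p q : I p -> I q -> I (p - q).
Proof. by move=> hp /idealN; apply: idealD. Qed.

Lemma idealZ c p : I p -> I (c *: p).
Proof. by move=> /(idealM c%:MP); rewrite mul_mpolyC. Qed.

Lemma ideal_sum (T : Type) (r : seq T) (P : pred T) (G : T -> {mpoly K[n]}) :
  (forall t, P t -> I (G t)) -> I (\sum_(t <- r | P t) G t).
Proof. by move=> h; elim/big_ind: _ => //; [exact: ideal0 | exact: idealD]. Qed.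

Lemma ideal_eqmod p q : I (p - q) -> I q -> I p.
Proof. by move=> h hq; rewrite -(subrK q p); apply: idealD. Qed.

Lemma ideal_scaleI (c : K) p : c != 0 -> I (c *: p) -> I p.
Proof. by move=> c0 /(idealZ c^-1); rewrite scalerA mulVf // scale1r. Qed.

Lemma homog_ideal_zpart d p : I p -> I (zpart d p).
Proof. by case: homI => _ h Ip; case: d => k /=; [apply: h | exact: ideal0]. Qed.

End HomogIdeal.

(** * Comparison of graded free resolutions *)

Section GradedMatrices.
Variables (n : nat) (K : fieldType).
Local Notation S := {mpoly K[n]}.

Definition graded_mx m q (dA : 'I_m -> int) (dB : 'I_q -> int) (M : 'M[S]_(m, q)) : Prop :=
  forall a b, zhomog (dA a - dB b) (M a b).

Definition graded_mx_part m q (dA : 'I_m -> int) (dB : 'I_q -> int) (M : 'M[S]_(m, q)) :=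
  \matrix_(a, b) zpart (dA a - dB b) (M a b).

Lemma graded_mxB m q (dA : 'I_m -> int) (dB : 'I_q -> int) M N :
  graded_mx dA dB M -> graded_mx dA dB N -> graded_mx dA dB (M - N).
Proof. by move=> hM hN a b; rewrite !mxE; apply: zhomogB. Qed.

Lemma graded_mxM m q r (dA : 'I_m -> int) (dB : 'I_q -> int) (dC : 'I_r -> int) M N :
  graded_mx dA dB M -> graded_mx dB dC N -> graded_mx dA dC (M *m N).
Proof.
move=> hM hN a c; rewrite mxE; apply: zhomog_sum => b _.
have -> : dA a - dC c = (dA a - dB b) + (dB b - dC c) by rewrite addrA subrK.
exact: zhomogM.
Qed.

Lemma graded_mx1 m (dA : 'I_m -> int) : graded_mx dA dA 1%:M.
Proof.
move=> a b; rewrite mxE; have [->|_] := eqVneq a b; last exact: zhomog0.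
by rewrite subrr -mpolyC1; apply: zhomogC.
Qed.

Lemma graded_mx_partM m q r (dA : 'I_m -> int) (dB : 'I_q -> int) (dC : 'I_r -> int) M N :
  graded_mx dB dC N -> graded_mx_part dA dC (M *m N) = graded_mx_part dA dB M *m N.
Proof.
move=> hN; apply/matrixP=> a c; rewrite !mxE zpart_sum; apply: eq_bigr => b _; rewrite mxE.
have -> : dA a - dC c = (dA a - dB b) + (dB b - dC c) by rewrite addrA subrK.
exact: zpartMr.
Qed.

Lemma graded_mx_partP m q (dA : 'I_m -> int) (dB : 'I_q -> int) M : graded_mx dA dB (graded_mx_part dA dB M).
Proof. by move=> a b; rewrite mxE; apply: zpart_homog. Qed.

Lemma graded_mx_part_id m q (dA : 'I_m -> int) (dB : 'I_q -> int) M :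
  graded_mx dA dB M -> graded_mx_part dA dB M = M.
Proof. by move=> h; apply/matrixP=> a b; rewrite mxE zpart_id. Qed.

(** Exactness only supplies ungraded lifts, row by row. The graded part of the assembled matrix is
    still a lift, because taking graded parts commutes with right multiplication by the graded
    matrix D. *)
Lemma graded_mx_lift m q r (dA : 'I_m -> int) (dB : 'I_q -> int) (dC : 'I_r -> int)
    (V : 'M[S]_(m, r)) (D : 'M[S]_(q, r)) :
  graded_mx dA dC V -> graded_mx dB dC D -> (forall a, exists w, row a V = w *m D) ->
  exists2 W, graded_mx dA dB W & V = W *m D.
Proof.
move=> hV hD /(@fin_all_exists _ _ _) [w hw].
have VE : V = (\matrix_a w a) *m D.
  by apply/row_matrixP=> a; rewrite row_mul rowK hw.
exists (graded_mx_part dA dB (\matrix_a w a)); first exact: graded_mx_partP.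
by rewrite -(graded_mx_partM _ _ hD) -VE graded_mx_part_id.
Qed.

(** What gradedness becomes over K, where a nonzero entry has degree 0. *)
Definition deg_preserving m q (dA : 'I_m -> int) (dB : 'I_q -> int) (M : 'M[K]_(m, q)) : Prop :=
  forall a b, M a b != 0 -> dA a = dB b.

(** Base change along S -> K sending all variables to 0. *)
Definition coef0_mx m q (M : 'M[S]_(m, q)) : 'M[K]_(m, q) := map_mx (mcoeff 0%MM) M.

Lemma coef0_mxM m q r (M : 'M[S]_(m, q)) (N : 'M[S]_(q, r)) : coef0_mx (M *m N) = coef0_mx M *m coef0_mx N.
Proof. exact: map_mxM. Qed.

Lemma graded_mx_coef0 m q (dA : 'I_m -> int) (dB : 'I_q -> int) M : graded_mx dA dB M -> deg_preserving dA dB (coef0_mx M).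
Proof. by move=> h a b; rewrite mxE => /(zhomog_coef0 (h a b)) /subr0_eq. Qed.

End GradedMatrices.

(** * Chain maps, homotopies and their reduction to K *)

Section Comparison.
Variables (n : nat) (K : fieldType) (I : {mpoly K[n]} -> Prop).
Hypothesis homI : is_homog_ideal I.
Local Notation S := {mpoly K[n]}.

Let ID := @idealD _ _ _ homI.
Let IM := @idealM _ _ _ homI.
Let IN := @idealN _ _ _ homI.
Let Isum := @ideal_sum _ _ _ homI.

(** The augmentation plays the role of the differential leaving degree 0, with zero read modulo I;
    lifting is then uniform in i. *)
Definition is_cycle (G : gfree_seq n K) i m : 'M[S]_(m, gf_rank G i) -> Prop :=
  match i return 'M[S]_(m, gf_rank G i) -> Prop with
  | 0 => fun V => forall a, I ((V *m gf_aug G) a 0)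
  | i'.+1 => fun V => V *m gf_diff G i' = 0
  end.

Lemma is_cycle_diff G i : gf_resolves I G -> is_cycle (gf_diff G i).
Proof.
case=> _ h0 h1; case: i => [|i] /=.
  move=> a; have /h0 : exists w, row a (gf_diff G 0) = w *m gf_diff G 0.
    by exists (delta_mx 0 a); rewrite -rowE.
  by rewrite -row_mul mxE.
apply/row_matrixP=> a; rewrite row_mul row0; apply/h1.
by exists (delta_mx 0 a); rewrite -rowE.
Qed.

Lemma is_cycle_lift G i m (dA : 'I_m -> int) (V : 'M[S]_(m, gf_rank G i)) :
  gf_graded G -> gf_resolves I G -> graded_mx dA (@gf_deg n K G i) V -> is_cycle V ->
  exists2 W, graded_mx dA (@gf_deg n K G i.+1) W & V = W *m gf_diff G i.
Proof.
move=> [_ gG] [_ h0 h1] hV cV; apply: graded_mx_lift hV _ _ => // a.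
case: i V cV => [|i] V /= cV; first by apply/h0; rewrite -row_mul mxE; apply: cV.
by apply/h1; rewrite -row_mul cV row0.
Qed.

Lemma chain_map F G :
  gf_graded F -> gf_resolves I F -> gf_graded G -> gf_resolves I G ->
  exists f : forall i, 'M[S]_(gf_rank F i, gf_rank G i),
    [/\ (forall i, graded_mx (@gf_deg n K F i) (@gf_deg n K G i) (f i)),
        (forall a, I ((gf_aug F - f 0%N *m gf_aug G) a 0)) &
        (forall i, gf_diff F i *m f i = f i.+1 *m gf_diff G i)].
Proof.
move=> gF rF gG rG.
have [f0 hf0 af0] : exists2 f0, graded_mx (@gf_deg n K F 0) (@gf_deg n K G 0) f0 &
    forall a, I ((gf_aug F - f0 *m gf_aug G) a 0).
  have [v hv] : exists v : 'I_(gf_rank F 0) -> 'rV_(gf_rank G 0),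
      forall a, I (gf_aug F a 0 - (v a *m gf_aug G) 0 0).
    apply: (@fin_all_exists _ (fun _ => 'rV_(gf_rank G 0))
      (fun a v => I (gf_aug F a 0 - (v *m gf_aug G) 0 0))) => a.
    by case: rG => h _ _; apply: h.
  exists (graded_mx_part (@gf_deg n K F 0) (@gf_deg n K G 0) (\matrix_a v a)); first exact: graded_mx_partP.
  move=> a; have := homog_ideal_zpart homI (gf_deg a) (hv a).
  rewrite zpartD zpartN (zpart_id (gF.1 a)) !mxE zpart_sum; congr (I (_ - _)).
  apply: eq_bigr => b _; rewrite !mxE.
  by rewrite -(zpartMr _ _ (gG.1 b)) subrK.
(* The components live in types depending on i and are built by recursion; the sigma type records,
   besides gradedness, the cycle condition that the next lift consumes. *)
pose st i := {M : 'M[S]_(gf_rank F i, gf_rank G i) |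
  graded_mx (@gf_deg n K F i) (@gf_deg n K G i) M /\ is_cycle (gf_diff F i *m M)}.
have cf0 : is_cycle (gf_diff F 0 *m f0).
  move=> a; have := is_cycle_diff 0 rF a; rewrite -mulmxA.
  have -> : f0 *m gf_aug G = gf_aug F - (gf_aug F - f0 *m gf_aug G) by rewrite opprB addrC subrK.
  rewrite mulmxBr => h; rewrite mxE; apply: ID => //; rewrite mxE; apply: IN.
  by rewrite mxE; apply: Isum => b _; apply: IM.
have step i (x : st i) : {y : st i.+1 | gf_diff F i *m sval x = sval y *m gf_diff G i}.
  apply: constructive_indefinite_description.
  case: x => M [gM cM] /=.
  have [W gW WE] := is_cycle_lift gG rG (graded_mxM (gF.2 i) gM) cM.
  have cW : is_cycle (gf_diff F i.+1 *m W).
    by rewrite /= -mulmxA -WE mulmxA (is_cycle_diff i.+1 rF) mul0mx.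
  by exists (exist _ W (conj gW cW)).

pose F_ := fix F_ i : st i := if i is i'.+1 then sval (step i' (F_ i')) else exist _ f0 (conj hf0 cf0).
exists (fun i => sval (F_ i)); split=> [i||i]; first by case: (svalP (F_ i)).
  exact: af0.
exact: (svalP (step i (F_ i))).
Qed.

(** The incoming component t is existential: the relation is used for one i at a time, so
    consecutive components need not be tied together. *)
Definition homotopy_at (F G : gfree_seq n K) (phi : forall i, 'M[S]_(gf_rank F i, gf_rank G i)) i :
    'M[S]_(gf_rank F i, gf_rank G i.+1) -> Prop :=
  match i return 'M[S]_(gf_rank F i, gf_rank G i.+1) -> Prop with
  | 0 => fun s => phi 0%N = s *m gf_diff G 0
  | i'.+1 => fun s => exists2 t, graded_mx (@gf_deg n K F i') (@gf_deg n K G i'.+1) t &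
               phi i'.+1 = s *m gf_diff G i'.+1 + gf_diff F i' *m t
  end.

Lemma null_homotopy F G (phi : forall i, 'M[S]_(gf_rank F i, gf_rank G i)) :
  gf_graded F -> gf_resolves I F -> gf_graded G -> gf_resolves I G ->
  (forall i, graded_mx (@gf_deg n K F i) (@gf_deg n K G i) (phi i)) ->
  (forall i, gf_diff F i *m phi i = phi i.+1 *m gf_diff G i) ->
  is_cycle (phi 0%N) ->
  forall i, exists2 s, graded_mx (@gf_deg n K F i) (@gf_deg n K G i.+1) s & homotopy_at phi s.
Proof.
move=> gF rF gG rG gphi cphi phi0; elim=> [|i [s gs hs]].
  by have [s gs hs] := is_cycle_lift gG rG (gphi 0%N) phi0; exists s.
have e0 : gf_diff F i *m (phi i - s *m gf_diff G i) = 0.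
  case: i s gs hs => [|i] s gs /=; first by move=> ->; rewrite subrr mulmx0.
  by case=> t _ ->; rewrite addrC addKr mulmxA (is_cycle_diff i.+1 rF) mul0mx.
have c1 : is_cycle (phi i.+1 - gf_diff F i *m s).
  by rewrite /= mulmxBl -cphi -mulmxA -mulmxBr.
have [s' gs' s'E] := is_cycle_lift gG rG (graded_mxB (gphi i.+1) (graded_mxM (gF.2 i) gs)) c1.
by exists s' => //=; exists s => //; rewrite -s'E subrK.
Qed.

Definition comparison_at (F G : gfree_seq n K) i (f : 'M[K]_(gf_rank F i, gf_rank G i))
    (g : 'M[K]_(gf_rank G i, gf_rank F i)) (s : 'M[K]_(gf_rank G i, gf_rank G i.+1)) : Prop :=
  match i return 'M[K]_(gf_rank F i, gf_rank G i) -> 'M[K]_(gf_rank G i, gf_rank F i) ->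
      'M[K]_(gf_rank G i, gf_rank G i.+1) -> Prop with
  | 0 => fun f g s => 1%:M = g *m f + s *m coef0_mx (gf_diff G 0)
  | i'.+1 => fun f g s => f *m coef0_mx (gf_diff G i') = 0 /\
       exists2 t, deg_preserving (@gf_deg n K G i') (@gf_deg n K G i'.+1) t &
         1%:M = g *m f + s *m coef0_mx (gf_diff G i'.+1) + coef0_mx (gf_diff G i') *m t
  end f g s.

(** Minimality makes the differential of F vanish over K. Hence the homotopy on F collapses to f g =
    1, while the one on G survives: F tensor K is the homology of G tensor K. *)
Lemma comparison_const F G i :
  minimal_graded_free_resolution I F -> gf_graded G -> gf_resolves I G ->
  exists f g s, [/\ deg_preserving (@gf_deg n K F i) (@gf_deg n K G i) f,
     deg_preserving (@gf_deg n K G i) (@gf_deg n K F i) g,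
     deg_preserving (@gf_deg n K G i) (@gf_deg n K G i.+1) s,
     f *m g = 1%:M /\ coef0_mx (gf_diff G i) *m g = 0 & comparison_at f g s].
Proof.
move=> [gF rF mF] gG rG.
have dF0 k : coef0_mx (gf_diff F k) = 0 by apply/matrixP=> a b; rewrite !mxE; apply: mF.
have [f [gf af cf]] := chain_map gF rF gG rG.
have [g [gg ag cg]] := chain_map gG rG gF rF.
have [s gs hs] : exists2 s, graded_mx (@gf_deg n K F i) (@gf_deg n K F i.+1) s &
    homotopy_at (fun k => 1%:M - f k *m g k) s.
  apply: null_homotopy => // [k|k|a].
  - by apply: graded_mxB (graded_mx1 _) _; apply: graded_mxM (gf k) (gg k).
  - by rewrite mulmxBr mulmxBl mulmx1 mul1mx mulmxA cf -!mulmxA cg.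
  rewrite mulmxBl mul1mx -mulmxA.
  have -> : g 0%N *m gf_aug F = gf_aug G - (gf_aug G - g 0%N *m gf_aug F) by rewrite opprB addrC subrK.
  rewrite mulmxBr opprB addrCA mxE; apply: ID; last exact: af.
  by rewrite mxE; apply: Isum => b _; apply: IM.
have [t gt ht] : exists2 t, graded_mx (@gf_deg n K G i) (@gf_deg n K G i.+1) t &
    homotopy_at (fun k => 1%:M - g k *m f k) t.
  apply: null_homotopy => // [k|k|a].
  - by apply: graded_mxB (graded_mx1 _) _; apply: graded_mxM (gg k) (gf k).
  - by rewrite mulmxBr mulmxBl mulmx1 mul1mx mulmxA cg -!mulmxA cf.
  rewrite mulmxBl mul1mx -mulmxA.
  have -> : f 0%N *m gf_aug G = gf_aug F - (gf_aug F - f 0%N *m gf_aug G) by rewrite opprB addrC subrK.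
  rewrite mulmxBr opprB addrCA mxE; apply: ID; last exact: ag.
  by rewrite mxE; apply: Isum => b _; apply: IM.
exists (coef0_mx (f i)), (coef0_mx (g i)), (coef0_mx t); split; try exact: graded_mx_coef0.
  split.
    rewrite -coef0_mxM; apply/eqP; rewrite eq_sym -subr_eq0; apply/eqP.
    have -> : 1%:M - coef0_mx (f i *m g i) = coef0_mx (1%:M - f i *m g i) by rewrite /coef0_mx map_mxB map_mx1.
    case: i s gs hs {t gt ht} => [|i] s gs /=; first by move=> ->; rewrite coef0_mxM dF0 mulmx0.
    by case=> u _ ->; rewrite /coef0_mx map_mxD -!/(coef0_mx _) !coef0_mxM !dF0 mulmx0 mul0mx addr0.
  by rewrite -coef0_mxM cg coef0_mxM dF0 mulmx0.
case: i t gt ht {s gs hs} => [|i] t gt /=.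
  move=> ht; rewrite -!coef0_mxM -ht /coef0_mx map_mxB map_mx1 addrC subrK //.
case=> u gu hu; split; first by rewrite -coef0_mxM -cf coef0_mxM dF0 mul0mx.
exists (coef0_mx u); first exact: graded_mx_coef0.
rewrite -!coef0_mxM -addrA -[coef0_mx (t *m _) + _]map_mxD -hu map_mxB map_mx1.
by rewrite addrC subrK.
Qed.

End Comparison.

(** * Linear algebra over K in a fixed internal degree *)

Section Blocks.
Variable K : fieldType.

Definition deg_block (j : int) m q (dA : 'I_m -> int) (dB : 'I_q -> int) (M : 'M[K]_(m, q)) :
    'M[K]_(#|[set a | dA a == j]|, #|[set b | dB b == j]|) :=
  \matrix_(a, b) M (enum_val a) (enum_val b).

Lemma deg_blockD j m q (dA : 'I_m -> int) (dB : 'I_q -> int) M N :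
  deg_block j dA dB (M + N) = deg_block j dA dB M + deg_block j dA dB N.
Proof. by apply/matrixP=> a b; rewrite !mxE. Qed.

Lemma deg_block0 j m q (dA : 'I_m -> int) (dB : 'I_q -> int) : deg_block j dA dB 0 = 0.
Proof. by apply/matrixP=> a b; rewrite !mxE. Qed.

Lemma deg_block1 j m (dA : 'I_m -> int) : deg_block j dA dA 1%:M = 1%:M.
Proof. by apply/matrixP=> a b; rewrite !mxE (inj_eq enum_val_inj). Qed.

Lemma deg_blockM j m q r (dA : 'I_m -> int) (dB : 'I_q -> int) (dC : 'I_r -> int) M N :
  deg_preserving dA dB M -> deg_block j dA dC (M *m N) = deg_block j dA dB M *m deg_block j dB dC N.
Proof.
move=> gM; apply/matrixP=> a c; rewrite !mxE.
rewrite (bigID [pred b | b \in [set b | dB b == j]]) /= addrC big1 ?add0r => [|b].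
  by rewrite big_enum_val; apply: eq_bigr => b _; rewrite !mxE.
rewrite inE => db; have [->|/gM ab] := eqVneq (M (enum_val a) b) 0; first by rewrite mul0r.
by have := enum_valP a; rewrite inE ab (negbTE db).
Qed.

(** The kernel of [dout] is the direct sum of the row spaces of f and [din]: the homotopy splits
    every cycle, and g kills boundaries but is injective on the image of f. Rank-nullity
    finishes. *)
Lemma homology_count m r p q (f : 'M[K]_(m, r)) (g : 'M[K]_(r, m)) (din : 'M[K]_(p, r))
    (dout : 'M[K]_(r, q)) (s : 'M[K]_(r, p)) (t : 'M[K]_(q, r)) :
  f *m g = 1%:M -> f *m dout = 0 -> din *m g = 0 -> din *m dout = 0 ->
  1%:M = g *m f + s *m din + dout *m t ->
  (m + \rank din + \rank dout = r)%N.
Proof.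
move=> fg fo ig io e1.
have rf : \rank f = m by apply/eqP/row_freeP; exists g.
have Z : (kermx dout :=: f + din)%MS.
  apply/eqmxP/andP; split; last by rewrite addsmx_sub !sub_kermx fo io !eqxx.
  have := congr1 (mulmx (kermx dout)) e1.
  rewrite mulmx1 !mulmxDr [_ *m (dout *m t)]mulmxA mulmx_ker mul0mx addr0 => ->.
  by rewrite !mulmxA addmx_sub_adds ?submxMl.
have dis : (f :&: din = 0)%MS.
  apply/eqP/rowV0P=> v; rewrite sub_capmx => /andP[/submxP[u ->] /submxP[w ew]].
  have : u *m f *m g = 0 by rewrite ew -mulmxA ig mulmx0.
  by rewrite -mulmxA fg mulmx1 => ->; rewrite mul0mx.
have := mxrank_ker dout; rewrite Z (mxrank_disjoint_sum dis) rf => ->.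
by rewrite subnK // rank_leq_row.
Qed.

End Blocks.

(** * Betti numbers of F from an arbitrary graded free resolution G *)

Section BettiFormula.
Variables (n : nat) (K : fieldType) (I : {mpoly K[n]} -> Prop).
Hypothesis homI : is_homog_ideal I.
Variables F G : gfree_seq n K.
Hypothesis minF : minimal_graded_free_resolution I F.
Hypotheses (gG : gf_graded G) (rG : gf_resolves I G).

Definition strand_diff i j := deg_block j (@gf_deg n K G i.+1) (@gf_deg n K G i) (coef0_mx (gf_diff G i)).

(** Indexed by the source: the rank of the map leaving homological degree i, hence 0 for i = 0. *)
Definition strand_rank i j := if i is i'.+1 then \rank (strand_diff i' j) else 0%N.

Lemma strand_diff_deg i : deg_preserving (@gf_deg n K G i.+1) (@gf_deg n K G i) (coef0_mx (gf_diff G i)).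
Proof. exact/graded_mx_coef0/gG.2. Qed.

Lemma betti_rank i j : (gf_betti F i j + strand_rank i.+1 j + strand_rank i j = gf_betti G i j)%N.
Proof.
have [f [g [s [cf cg cs [fg dg]]]]] := comparison_const homI i minF gG rG.
have fgj : deg_block j (@gf_deg n K F i) (@gf_deg n K G i) f *m deg_block j (@gf_deg n K G i) (@gf_deg n K F i) g = 1%:M.
  by rewrite -deg_blockM // fg deg_block1.
have dgj : strand_diff i j *m deg_block j (@gf_deg n K G i) (@gf_deg n K F i) g = 0.
  by rewrite -deg_blockM ?dg ?deg_block0 //; apply: strand_diff_deg.
rewrite /strand_rank -/(strand_rank i j); case: i f g s cf cg cs {fg dg} fgj dgj => [|i] f g s cf cg cs fgj dgj /=.
  move/(congr1 (deg_block j (@gf_deg n K G 0) (@gf_deg n K G 0))).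
  rewrite deg_block1 deg_blockD !(deg_blockM _ _ _ cg) (deg_blockM _ _ _ cs) => e1.
  (* In degree 0 the outgoing differential is the map to a space of dimension 0. *)
  have e2 : 1%:M = deg_block j (@gf_deg n K G 0) (@gf_deg n K F 0) g *m deg_block j (@gf_deg n K F 0) (@gf_deg n K G 0) f
     + deg_block j (@gf_deg n K G 0) (@gf_deg n K G 1) s *m strand_diff 0 j + (0 : 'M_(_, 0)) *m (0 : 'M_(0, _)).
    by rewrite mulmx0 addr0.
  by have := homology_count fgj (mulmx0 _ _) dgj (mulmx0 _ _) e2; rewrite mxrank0.
case=> fd [t ct] /(congr1 (deg_block j (@gf_deg n K G i.+1) (@gf_deg n K G i.+1))).
rewrite deg_block1 !deg_blockD !(deg_blockM _ _ _ cg) (deg_blockM _ _ _ cs) (deg_blockM _ _ _ (@strand_diff_deg i)) => e1.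
apply: homology_count fgj _ dgj _ e1.
  by rewrite -deg_blockM // fd deg_block0.
rewrite /strand_diff -deg_blockM; last exact: strand_diff_deg.
by rewrite -coef0_mxM (is_cycle_diff i.+1 rG) /coef0_mx map_mx0 deg_block0.
Qed.

(** The rows of f are cycles, so by assumption boundaries, and g kills boundaries; then f g = 1
    forces the identity matrix to have size 0. *)
Lemma betti_vanish i j :
  (forall z : 'rV[K]_(gf_betti G i j),
     (if i is i'.+1 return 'rV[K]_(gf_betti G i j) -> Prop
      then fun z => z *m strand_diff i' j = 0 else fun _ => True) z ->
     (z <= strand_diff i j)%MS) -> gf_betti F i j = 0%N.
Proof.
have [f [g [s [cf cg cs [fg dg]]]]] := comparison_const homI i minF gG rG.
have fgj : deg_block j (@gf_deg n K F i) (@gf_deg n K G i) f *m deg_block j (@gf_deg n K G i) (@gf_deg n K F i) g = 1%:M.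
  by rewrite -deg_blockM // fg deg_block1.
have dgj : strand_diff i j *m deg_block j (@gf_deg n K G i) (@gf_deg n K F i) g = 0.
  by rewrite -deg_blockM ?dg ?deg_block0 //; apply: strand_diff_deg.
move=> cp h; have : (deg_block j (@gf_deg n K F i) (@gf_deg n K G i) f <= strand_diff i j)%MS.
  apply/row_subP=> a; apply: h.
  case: i f g s cf cg cs {fg dg} fgj dgj cp a => [|i] f g s cf cg cs fgj dgj //= [fd _] a.
  by rewrite -row_mul -deg_blockM // fd deg_block0 row0.
case/submxP=> w wE; move: fgj; rewrite wE -mulmxA dgj mulmx0 => /esym/(congr1 mxrank).
by rewrite mxrank1 mxrank0.
Qed.

End BettiFormula.

(** * Minimalization by cancelling unit entries *)

Section BasedResolutions.
Variables (n : nat) (K : fieldType) (I : {mpoly K[n]} -> Prop).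
Hypothesis homI : is_homog_ideal I.
Local Notation S := {mpoly K[n]}.
Variables (X : finType) (hd : X -> nat) (dg : X -> int).

Let I0 := ideal0 homI.
Let ID := @idealD _ _ _ homI.
Let IM := @idealM _ _ _ homI.
Let IB := @idealB _ _ _ homI.

(* A graded free resolution with all its bases collected in one finite type X:
   hd and dg are the homological and internal degrees, P is the set of basis
   elements in use, and D is the matrix of the total differential.  Keeping X
   fixed and shrinking P avoids dependent types when basis elements are
   cancelled.  Since aug lives in hd 0 and D lowers hd by one, br_exact says
   that all homology of the augmented complex vanishes. *)
Record based_res (P : {set X}) (D : X -> X -> S) (aug : X -> S) : Prop := BasedRes {
  br_lev : forall x y, hd x != (hd y).+1 -> D x y = 0;
  br_auglev : forall x, hd x != 0%N -> aug x = 0;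
  br_hom : forall x y, zhomog (dg x - dg y) (D x y);
  br_aughom : forall x, zhomog (dg x) (aug x);
  br_sq : forall x z, x \in P -> z \in P -> \sum_(y in P) D x y * D y z = 0;
  br_augI : forall x, x \in P -> I (\sum_(y in P) D x y * aug y);
  br_surj : forall p, exists v : X -> S, I (p - \sum_(x in P) v x * aug x);
  br_exact : forall v : X -> S, (forall y, y \in P -> \sum_(x in P) v x * D x y = 0) ->
    I (\sum_(x in P) v x * aug x) ->
    exists w : X -> S, forall y, y \in P -> v y = \sum_(x in P) w x * D x y }.

(* D' is the Schur complement of the unit entry D x0 y0. *)
Lemma based_res_cancel P D aug x0 y0 :
  based_res P D aug -> x0 \in P -> y0 \in P -> (D x0 y0)@_0%MM != 0 ->
  exists D', based_res (P :\ x0 :\ y0) D' aug.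
Proof.
move=> [lev auglev hom aughom sq augI surj exact] x0P y0P c0.
have hx0 : hd x0 = (hd y0).+1.
  by apply/eqP; apply: contraNT c0 => /lev ->; rewrite mcoeff0.
have xy0 : x0 != y0 by apply: contra_eqN hx0 => /eqP->; rewrite neq_ltn ltnSn.
have dxy : dg x0 = dg y0 by apply/subr0_eq/(zhomog_coef0 (hom x0 y0)).
have [c cD] : exists c : S, zhomog 0 c /\ c * D x0 y0 = 1.
  exists (((D x0 y0)@_0%MM)^-1)%:MP; split; first exact: zhomogC.
  have := hom x0 y0; rewrite dxy subrr => /zhomog_const {2}->.
  by rewrite -mpolyCM mulVf.
case: cD => homc cD.
have Dxx x : D x x = 0 by apply: lev; rewrite neq_ltn ltnSn.
set P' := P :\ x0 :\ y0.
have split_sum (G : X -> S) : \sum_(x in P) G x = G x0 + (G y0 + \sum_(x in P') G x).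
  by rewrite (big_setD1 x0) //= (big_setD1 y0) // !inE eq_sym xy0.
have P'P x : x \in P' -> x \in P by rewrite !inE => /and3P[].
pose D' x y := D x y - D x y0 * c * D x0 y.
have sumD'l (v : X -> S) y : \sum_(x in P') v x * D' x y =
    \sum_(x in P') v x * D x y - (\sum_(x in P') v x * D x y0) * c * D x0 y.
  rewrite !mulr_suml -sumrB; apply: eq_bigr => x _; rewrite /D'; ring.
have sumD'r (v : X -> S) x : \sum_(y in P') D' x y * v y =
    \sum_(y in P') D x y * v y - D x y0 * c * (\sum_(y in P') D x0 y * v y).
  rewrite !mulr_sumr -sumrB; apply: eq_bigr => y _; rewrite /D'; ring.
have sq' x z : x \in P -> z \in P ->
    \sum_(y in P') D x y * D y z = - (D x x0 * D x0 z) - D x y0 * D y0 z.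
  move=> xP zP; have := sq x z xP zP; rewrite split_sum addrA => /eqP.
  by rewrite addrC addr_eq0 opprD => /eqP.
have aug0 : aug x0 = 0 by apply: auglev; rewrite hx0.
have augI' x : x \in P -> I (\sum_(y in P') D x y * aug y + D x y0 * aug y0).
  by move=> xP; have := augI x xP; rewrite split_sum aug0 mulr0 add0r addrC.
exists D'; split=> //.
- move=> x y hxy; rewrite /D' lev // sub0r.
  have [e|/lev->] := eqVneq (hd x) (hd y0).+1; last by rewrite !mul0r oppr0.
  by rewrite (lev x0 y) ?mulr0 ?oppr0 // hx0 -e.
- move=> x y; apply: zhomogB => //.
  have -> : dg x - dg y = (dg x - dg y0) + 0 + (dg x0 - dg y).
    by rewrite addr0 dxy addrA subrK.
  by do !apply: zhomogM.
- move=> x z xP' zP'; rewrite sumD'l.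
  have xP := P'P x xP'; have zP := P'P z zP'.
  rewrite !sumD'r !sq' // !Dxx.
  ring: cD.
- move=> x xP'; have xP := P'P x xP'; rewrite sumD'r.
  have h := IB (augI' x xP) (IM (D x y0 * c) (augI' x0 x0P)).
  move: h; congr I; rewrite mulrDr mulrA.
  ring: cD.
- move=> p; have [v] := surj p; rewrite split_sum aug0 mulr0 add0r => hv.
  (* Modulo I the boundary of x0 expresses [aug y0] through the other generators, c being the
     inverse of [D x0 y0]. *)
  exists (fun x => v x - v y0 * c * D x0 x).
  have := IB hv (IM (- (v y0 * c)) (augI' x0 x0P)); congr I.
  have -> : \sum_(x in P') (v x - v y0 * c * D x0 x) * aug x =
     \sum_(x in P') v x * aug x - v y0 * c * (\sum_(x in P') D x0 x * aug x).
    rewrite mulr_sumr -sumrB; apply: eq_bigr => x _; ring.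
  ring: cD.
- move=> v hv av.
  (* v is extended to P by 0 at y0 and, at x0, by the value that cancels the y0 component of its
     boundary. *)
  pose vx := - (\sum_(x in P') v x * D x y0) * c.
  pose v' x := if x == x0 then vx else if x == y0 then 0 else v x.
  have v'x0 : v' x0 = vx by rewrite /v' eqxx.
  have v'y0 : v' y0 = 0 by rewrite /v' eq_sym (negbTE xy0) eqxx.
  have v'P x : x \in P' -> v' x = v x.
    by rewrite /v' !inE => /and3P[/negbTE -> /negbTE ->].
  have sv' (G : X -> S) : \sum_(x in P) v' x * G x = vx * G x0 + \sum_(x in P') v x * G x.
    rewrite split_sum v'x0 v'y0 mul0r add0r; congr (_ + _).
    by apply: eq_bigr => x /v'P ->.
  pose u y := \sum_(x in P) v' x * D x y.
  have uy0 : u y0 = 0 by rewrite /u sv' /vx; ring: cD.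
  have uP' y : y \in P' -> u y = 0.
    by move=> yP'; rewrite /u sv' -[RHS](hv y yP') sumD'l /vx; ring.
  (* The boundary u has boundary zero, and the y0 component of the latter is [u x0 * D x0 y0] with
     [D x0 y0] a unit. *)
  have ux0 : u x0 = 0.
    have : \sum_(y in P) u y * D y y0 = 0.
      rewrite /u; under eq_bigr do rewrite mulr_suml.
      rewrite exchange_big big1 //= => x xP; under eq_bigr do rewrite -mulrA.
      by rewrite -mulr_sumr sq // mulr0.
    rewrite split_sum uy0 mul0r add0r big1 => [|y /uP' ->]; last by rewrite mul0r.
    by rewrite addr0 => h; rewrite -[u x0]mulr1 -cD mulrCA h mulr0.
  have u0 y : y \in P -> u y = 0.
    move=> yP; have [->//|n1] := eqVneq y x0; have [->//|n2] := eqVneq y y0.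
    by apply: uP'; rewrite !inE n1 n2.
  have av' : I (\sum_(x in P) v' x * aug x) by rewrite sv' aug0 mulr0 add0r.
  have [w hw] := exact v' u0 av'.
  have := hw y0 y0P; rewrite v'y0 split_sum Dxx mulr0 add0r => w0.
  (* The coefficient of w at y0 is moved to the remaining basis elements through the relation d x0 =
     0, in which y0 has a unit coefficient. *)
  exists (fun x => w x - c * w y0 * D x0 x) => y yP'.
  rewrite -(v'P y yP') (hw y (P'P y yP')) split_sum sumD'l.
  have e z : \sum_(x in P') (w x - c * w y0 * D x0 x) * D x z =
    \sum_(x in P') w x * D x z - c * w y0 * (\sum_(x in P') D x0 x * D x z).
    rewrite mulr_sumr -sumrB; apply: eq_bigr => x _; ring.
  rewrite !e !sq' ?(P'P y yP') // !Dxx.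
  set A := \sum_(x in P') w x * D x y0 in w0 *.
  have wE : w x0 = - (c * A).
    have : c * (w x0 * D x0 y0 + A) = 0 by rewrite -w0 mulr0.
    by rewrite mulrDr mulrCA cD mulr1 => /eqP; rewrite addr_eq0 => /eqP.
  rewrite wE; ring: cD.
Qed.

Definition based_minimal (P : {set X}) (D : X -> X -> S) : Prop :=
  forall x y, x \in P -> y \in P -> (D x y)@_0%MM = 0.

Lemma based_res_minimal P D aug :
  based_res P D aug -> exists P' D', based_res P' D' aug /\ based_minimal P' D'.
Proof.
have [k] := ubnP #|P|; elim: k P D => // k IH P D lek res.
have [/forall_inP mP|/forall_inPn[x xP /forall_inPn[y yP Dxy]]] :=
    boolP [forall x in P, forall y in P, (D x y)@_0%MM == 0].
  by exists P, D; split=> // x y /mP/forall_inP h /h/eqP.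
have [D' res'] := based_res_cancel res xP yP Dxy.
rewrite ltnS in lek; apply: (IH _ _ _ res'); apply: leq_trans lek.
rewrite (cardsD1 x P) xP add1n ltnS; exact/subset_leq_card/subD1set.
Qed.

(** * From a based resolution to a sequence of free modules *)

Section Convert.
Variables (P : {set X}) (D : X -> X -> S) (aug : X -> S).

Definition lvl i := [set x in P | hd x == i].

Definition gf_of : gfree_seq n K :=
  @GFreeSeq n K (fun i => #|lvl i|) (fun i k => dg (enum_val k))
    (\col_k aug (enum_val k)) (fun i => \matrix_(a, b) D (enum_val a) (enum_val b)).

Lemma sum_lvl i (V : zmodType) (G : X -> V) : (forall x, hd x != i -> G x = 0) ->
  \sum_(x in P) G x = \sum_(k < #|lvl i|) G (enum_val k).
Proof.
move=> h; rewrite -big_enum_val [LHS](bigID (fun x => hd x == i)) /= [X in _ + X]big1 ?addr0.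
  by apply: eq_bigl => x; rewrite inE.
by move=> x /andP[_ /h].
Qed.

(** Extension by zero to X; at most one summand survives since [enum_val] is injective. *)
Definition lvl_ext (V : zmodType) i (v : 'rV[V]_(#|lvl i|)) (x : X) : V :=
  \sum_k v 0 k *+ (enum_val k == x).

Lemma lvl_extE (V : zmodType) i (v : 'rV[V]_(#|lvl i|)) k : lvl_ext v (enum_val k) = v 0 k.
Proof.
rewrite /lvl_ext (bigD1 k) //= eqxx big1 ?addr0 // => l lk.
by rewrite (inj_eq enum_val_inj) (negbTE lk).
Qed.

Lemma lvl_ext0 (V : zmodType) i (v : 'rV[V]_(#|lvl i|)) x : hd x != i -> lvl_ext v x = 0.
Proof.
move=> hx; rewrite /lvl_ext big1 // => k _; have [e|] := eqVneq (enum_val k) x => //.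
by have := enum_valP k; rewrite e inE (negbTE hx) andbF.
Qed.

Hypothesis res : based_res P D aug.

Lemma gf_of_graded : gf_graded gf_of.
Proof.
by split=> [k|i a b]; rewrite mxE /=; [apply: br_aughom res _ | apply: br_hom res _ _].
Qed.

Lemma gf_of_minimal : based_minimal P D -> gf_minimal gf_of.
Proof.
move=> m i a b; rewrite mxE; apply: m.
  by have := enum_valP a; rewrite inE => /andP[].
by have := enum_valP b; rewrite inE => /andP[].
Qed.

Lemma mul_gf_diff i (v : 'rV[S]_(#|lvl i.+1|)) k :
  (v *m gf_diff gf_of i) 0 k = \sum_(x in P) lvl_ext v x * D x (enum_val k).
Proof.
rewrite (@sum_lvl i.+1) => [|x hx]; last by rewrite lvl_ext0 ?mul0r.
by rewrite mxE; apply: eq_bigr => a _; rewrite mxE lvl_extE.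
Qed.

Lemma mul_gf_aug (v : 'rV[S]_(#|lvl 0|)) :
  (v *m gf_aug gf_of) 0 0 = \sum_(x in P) lvl_ext v x * aug x.
Proof.
rewrite (@sum_lvl 0) => [|x hx]; last by rewrite lvl_ext0 ?mul0r.
by rewrite mxE; apply: eq_bigr => a _; rewrite mxE lvl_extE.
Qed.

Lemma lvl_extP i (v : 'rV[S]_(#|lvl i|)) y : y \in P -> hd y = i ->
  exists2 k : 'I_(#|lvl i|), y = enum_val k & lvl_ext v y = v 0 k.
Proof.
move=> yP hy; have yl : y \in lvl i by rewrite inE yP hy eqxx.
by exists (enum_rank_in yl y); rewrite -?lvl_extE enum_rankK_in.
Qed.

Lemma boundary_lvl i (w : X -> S) (v : 'rV[S]_(#|lvl i|)) :
  (forall y, y \in P -> lvl_ext v y = \sum_(x in P) w x * D x y) ->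
  v = (\row_k w (enum_val k)) *m gf_diff gf_of i.
Proof.
move=> hw; apply/rowP=> k; have := enum_valP k; rewrite inE => /andP[kP /eqP hk].
rewrite -lvl_extE hw // (@sum_lvl i.+1) => [|x hx]; last by rewrite (br_lev res) ?mulr0 ?hk.
by rewrite mxE; apply: eq_bigr => a _; rewrite !mxE.
Qed.

Lemma lvl_in i (k : 'I_(#|lvl i|)) : enum_val k \in P /\ hd (enum_val k) = i.
Proof. by have := enum_valP k; rewrite inE => /andP[? /eqP]. Qed.

(** A vector supported in one level has its boundary supported in the level below, so the global
    exactness of [based_res] splits into exactness at each level. *)
Lemma gf_of_resolves : gf_resolves I gf_of.
Proof.
have lev := br_lev res.
have D0 (v : X -> S) (i : nat) : (forall x, hd x != i -> v x = 0) ->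
    forall y, (hd y).+1 != i -> \sum_(x in P) v x * D x y = 0.
  move=> hv y hy; rewrite big1 // => x _; have [e|/hv->] := eqVneq (hd x) i; last by rewrite mul0r.
  by rewrite lev ?mulr0 // e eq_sym.
have extmul i (w : 'rV[S]_(#|lvl i.+1|)) y : y \in P ->
    lvl_ext (w *m gf_diff gf_of i) y = \sum_(x in P) lvl_ext w x * D x y.
  move=> yP; have [hy|hy] := eqVneq (hd y) i.
    by have [k -> ->] := lvl_extP (w *m gf_diff gf_of i) yP hy; rewrite mul_gf_diff.
  by rewrite lvl_ext0 // (D0 _ i.+1) // => x hx; apply: lvl_ext0.
split=> [p|v|i v].
- have [v hv] := br_surj res p; exists (\row_k v (enum_val k)).
  move: hv; rewrite (@sum_lvl 0) => [|x hx]; last by rewrite (br_auglev res) ?mulr0.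
  by congr (I (_ - _)); rewrite mxE; apply: eq_bigr => a _; rewrite !mxE.
- split=> [hv|[w ->]].
    rewrite mul_gf_aug in hv.
    have [|w /boundary_lvl ->] := br_exact res _ hv; last by exists (\row_k w (enum_val k)).
    by move=> y _; apply: (D0 _ 0%N) => // x hx; apply: lvl_ext0.
  rewrite mul_gf_aug (eq_bigr (fun y => \sum_(x in P) lvl_ext w x * D x y * aug y)) => [|y yP].
    rewrite exchange_big /=; elim/big_ind: _ => //= x xP.
    rewrite (eq_bigr (fun y => lvl_ext w x * (D x y * aug y))) => [|y _]; last by rewrite mulrA.
    by rewrite -mulr_sumr; apply/IM/(br_augI res).
  by rewrite extmul // mulr_suml.
- split=> [hv|[w ->]].
    have [||w /boundary_lvl ->] := br_exact res (v := lvl_ext v); last by exists (\row_k w (enum_val k)).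
      move=> y yP; have [hy|hy] := eqVneq (hd y) i; last first.
        by apply: (D0 _ i.+1) => // x hx; apply: lvl_ext0.
      have [k -> _] := lvl_extP (0 : 'rV_(#|lvl i|)) yP hy.
      by rewrite -mul_gf_diff hv mxE.
    rewrite big1 // => x _; have [e|/lvl_ext0->] := eqVneq (hd x) i.+1; last by rewrite mul0r.
    by rewrite (br_auglev res) ?mulr0 // e.
  apply/rowP=> k; have [kP _] := lvl_in k; rewrite mul_gf_diff mxE.
  rewrite (eq_bigr (fun y => \sum_(x in P) lvl_ext w x * D x y * D y (enum_val k))) => [|y yP].
    rewrite exchange_big big1 //= => x xP.
    rewrite (eq_bigr (fun y => lvl_ext w x * (D x y * D y (enum_val k)))) => [|y _]; last by rewrite mulrA.
    by rewrite -mulr_sumr (br_sq res) ?mulr0.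
  by rewrite extmul // mulr_suml.
Qed.

End Convert.

Lemma based_res_exists_minimal P D aug :
  based_res P D aug -> exists F, minimal_graded_free_resolution I F.
Proof.
move=> /based_res_minimal [P' [D' [res m]]]; exists (gf_of P' D' aug).
by split; [apply: gf_of_graded | apply: gf_of_resolves | apply: gf_of_minimal].
Qed.

End BasedResolutions.

(** * The Koszul resolution of a graded quotient of finite length *)

Section KoszulSigns.
Variables (n : nat) (K : fieldType).
Local Notation S := {mpoly K[n]}.
Implicit Types (i k : 'I_n) (J : {set 'I_n}).

(** The number of factors of e_J that e_i passes on its way to its sorted place. *)
Definition kos_sign i J : nat := #|[set j in J | (j < i)%N]|.

Lemma kos_signU1 i k J : i \notin J -> kos_sign k (i |: J) = ((i < k) + kos_sign k J)%N.
Proof.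
move=> iJ; rewrite /kos_sign; case: (ltnP i k) => ik.
  rewrite (_ : [set j in i |: J | _] = i |: [set j in J | (j < k)%N]).
    by rewrite cardsU1 inE (negbTE iJ).
  by apply/setP=> j; rewrite !inE; case: eqVneq => [->|] //=; rewrite ik.
rewrite add0n; apply: eq_card => j; rewrite !inE.
by case: eqVneq => [->|] //=; rewrite ltnNge ik (negbTE iJ).
Qed.

Lemma kos_signD1 i k J : i \in J -> kos_sign k J = ((i < k) + kos_sign k (J :\ i))%N.
Proof. by move=> iJ; rewrite -{1}(setD1K iJ) kos_signU1 // !inE eqxx. Qed.

(* u assigns to J the coefficient of the exterior monomial e_J; kos_diff is the
   contraction with x_1, ..., x_n and kos_htpy the wedge with the operators beta. *)
Definition kos_diff (u : {set 'I_n} -> S) J : S :=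
  \sum_(i | i \notin J) (-1) ^+ kos_sign i J * ('X_i * u (i |: J)).

Definition kos_htpy (beta : 'I_n -> {linear S -> S}) (u : {set 'I_n} -> S) J : S :=
  \sum_(i | i \in J) (-1) ^+ kos_sign i J * beta i (u (J :\ i)).

Lemma signMsq (R : comNzRingType) a (x : R) : (-1) ^+ a * ((-1) ^+ a * x) = x.
Proof. by rewrite mulrA -expr2 sqrr_sign mul1r. Qed.

(* The cross terms of the two composites cancel because contracting i and
   wedging k pick up opposite signs in the two orders. *)
Lemma kos_diff_htpy (beta : 'I_n -> {linear S -> S}) (c : K) (u : {set 'I_n} -> S) J :
  (forall i k p, beta k ('X_i * p) = 'X_i * beta k p + (c *: p) *+ (i == k)) ->
  kos_diff (kos_htpy beta u) J + kos_htpy beta (kos_diff u) J =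
  \sum_i 'X_i * beta i (u J) + (c *: u J) *+ #|J|.
Proof.
move=> hb.
have bsign k e p : beta k ((-1) ^+ e * p) = (-1) ^+ e * beta k p by apply: raddfMsign.
have -> : kos_diff (kos_htpy beta u) J = \sum_(i | i \notin J) 'X_i * beta i (u J)
    + \sum_(i | i \notin J) \sum_(k | k \in J)
       (-1) ^+ kos_sign i J * ('X_i * ((-1) ^+ kos_sign k (i |: J) * beta k (u (i |: (J :\ k))))).
  rewrite -big_split /=; apply: eq_bigr => i iJ.
  rewrite /kos_htpy (bigD1 i) ?setU11 //= mulrDr mulrDr setU1K // (kos_signU1 _ iJ) ltnn add0n.
  rewrite [in X in X + _]mulrCA signMsq; congr (_ + _).
  rewrite !mulr_sumr; apply: eq_big => [k|k /andP[kJ ki]].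
    by rewrite !inE; case: eqVneq => [->|] /=; rewrite ?andbT ?(negbTE iJ).
  congr (_ * ('X_i * (_ * beta k (u _)))); apply/setP=> j; rewrite !inE.
  by case: (j =P i) => [->|]; rewrite ?orbF // eq_sym ki.
have -> : kos_htpy beta (kos_diff u) J = \sum_(k | k \in J) ('X_k * beta k (u J) + c *: u J)
    + \sum_(k | k \in J) \sum_(i | i \notin J)
       (-1) ^+ kos_sign k J * ((-1) ^+ kos_sign i (J :\ k) * ('X_i * beta k (u (i |: (J :\ k))))).
  rewrite -big_split /=; apply: eq_bigr => k kJ.
  rewrite /kos_diff linear_sum (bigD1 k) ?setD11 //= mulrDr setD1K //; congr (_ + _).
    by rewrite bsign hb eqxx (kos_signD1 k kJ) ltnn add0n signMsq.
  rewrite mulr_sumr; apply: eq_big => [i|i].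
    by rewrite !inE; case: eqVneq => [->|] /=; rewrite ?kJ ?andbT.
  by move=> /andP[_ ik]; rewrite bsign hb (negbTE ik) mulr0n addr0.
rewrite addrACA [X in _ + X](_ : _ = 0) ?addr0; last first.
  rewrite [X in _ + X]exchange_big -big_split big1 //= => i iJ.
  rewrite -big_split big1 //= => k kJ.
  rewrite (kos_signU1 k iJ) (kos_signD1 i kJ) !exprD.
  have : (-1) ^+ (k < i)%N * (-1) ^+ (i < k)%N = -1 :> S.
    have : i != k by apply: contraNneq iJ => ->.
    by case: (ltngtP k i) => [||/val_inj ->]; rewrite ?eqxx // expr0 expr1 ?mulr1 ?mul1r.
  move: ((-1) ^+ (k < i)%N) ((-1) ^+ (i < k)%N) ((-1) ^+ kos_sign k J) ((-1) ^+ kos_sign i _).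
  move=> a b x y ab; ring: ab.
rewrite big_split /= addrA; congr (_ + _); last by rewrite sumr_const.
by rewrite addrC [RHS](bigID (mem J)).
Qed.

Lemma kos_diffD u v J : kos_diff (fun J => u J + v J) J = kos_diff u J + kos_diff v J.
Proof. by rewrite -big_split; apply: eq_bigr => i _; rewrite !mulrDr. Qed.

Lemma kos_diffMl p u J : kos_diff (fun J => p * u J) J = p * kos_diff u J.
Proof. by rewrite mulr_sumr; apply: eq_bigr => i _; ring. Qed.

(** Euler's identity, read off on monomials: x_i d/dx_i multiplies X^m by m_i. *)
Lemma euler_mderiv (p : S) (d : nat) : p \is d.-homog ->
  \sum_i 'X_i * p^`M(i) = d%:R *: p.
Proof.
move=> hp; rewrite {2}[p]mpolyE scaler_sumr.
have pE i : p^`M(i) = \sum_(m <- msupp p) p@_m *: ('X_[m])^`M(i).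
  by rewrite {1}[p]mpolyE linear_sum; apply: eq_bigr => m _; apply: mderivZ.
under eq_bigr => i _ do rewrite pE mulr_sumr.
rewrite exchange_big /= [LHS]big_seq [RHS]big_seq; apply: eq_bigr => m mp.
rewrite -(dhomog_mf hp mp) /= mdegE natr_sum scaler_suml; apply: eq_bigr => i _.
rewrite mderivX -scalerAr -scalerAr scalerA mulrC -scalerA.
have [->|mi] := posnP (m i); first by rewrite !scale0r.
rewrite -mpolyXD; congr (_ *: (_ *: mpolyX K _)).
by rewrite addmC submK //; apply/mnm_lepP=> k; rewrite mnm1E; case: eqVneq => [<-|].
Qed.

End KoszulSigns.

Section DegreeBound.
Variables (n : nat) (K : fieldType).
Local Notation S := {mpoly K[n]}.

Definition deg_le (d : nat) (p : S) : Prop := forall m, (d < mdeg m)%N -> p@_m = 0.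

Lemma deg_leD d p q : deg_le d p -> deg_le d q -> deg_le d (p + q).
Proof. by move=> hp hq m dm; rewrite mcoeffD hp ?hq ?addr0. Qed.

Lemma deg_leN d p : deg_le d p -> deg_le d (- p).
Proof. by move=> hp m dm; rewrite mcoeffN hp ?oppr0. Qed.

Lemma deg_le_sum d (T : Type) (r : seq T) (P : pred T) (G : T -> S) :
  (forall t, P t -> deg_le d (G t)) -> deg_le d (\sum_(t <- r | P t) G t).
Proof.
move=> h; elim/big_ind: _ => //; last exact: deg_leD.
by move=> m _; rewrite mcoeff0.
Qed.

Lemma deg_leMsign d e p : deg_le d p -> deg_le d ((-1) ^+ e * p).
Proof. by move=> h; rewrite -signr_odd mulr_sign; case: ifP => // _; apply: deg_leN. Qed.

Lemma deg_leMC d p c : deg_le d p -> deg_le d (p * c%:MP).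
Proof. by move=> hp m dm; rewrite mulrC mcoeffCM hp ?mulr0. Qed.

Lemma deg_le_msize p : deg_le (msize p) p.
Proof.
move=> m dm; apply: memN_msupp_eq0; apply/negP=> /msize_mdeg_lt.
by rewrite ltnNge (ltnW dm).
Qed.

Lemma deg_le_zpart_sub d p : deg_le d.+1 p -> deg_le d (p - zpart d.+1%:Z p).
Proof.
move=> hp m dm; rewrite mcoeffB mcoeff_zpart eqz_nat; case: eqVneq => [_|ne]; first by rewrite subrr.
by rewrite subr0 hp // ltn_neqAle eq_sym ne.
Qed.

Lemma deg_le_mderiv d p i : zhomog d.+1%:Z p -> deg_le d (p^`M(i)).
Proof.
move=> /zhomogP hp m dm; rewrite mcoeff_mderiv hp ?mul0rn //.
by rewrite mdegD mdeg1 addn1 eqz_nat eqSS neq_ltn dm orbT.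
Qed.

Lemma zhomogX i : zhomog 1 ('X_i : S).
Proof. by apply/(zhomog_dhomog 1); rewrite dhomogX /= mdeg1. Qed.

Lemma zpartXM d i (p : S) : zpart d.+1%:Z ('X_i * p) = 'X_i * zpart d%:Z p.
Proof. by rewrite mulrC -addn1 PoszD (zpartMr _ _ (@zhomogX i)) mulrC. Qed.

Lemma zpart_deg_le d e p : deg_le d p -> (d < e)%N -> zpart e%:Z p = 0.
Proof.
move=> hp de; apply/mpolyP=> m; rewrite mcoeff_zpart mcoeff0; case: eqP => // -[me].
by apply: hp; rewrite me.
Qed.

Lemma zpartMsign d e (p : S) : zpart d ((-1) ^+ e * p) = (-1) ^+ e * zpart d p.
Proof. by rewrite -signr_odd !mulr_sign; case: ifP => // _; rewrite zpartN. Qed.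

End DegreeBound.

(** * Exactness of the Koszul complex of the operators x_i - M_i *)

Section KoszulResolution.
Variables (n : nat) (K : fieldType) (I : {mpoly K[n]} -> Prop).
Hypothesis charK : [pchar K] =i pred0.
Hypothesis homI : is_homog_ideal I.
Local Notation S := {mpoly K[n]}.
Variables (Y : finType) (e : Y -> S) (dgY : Y -> nat) (M : 'I_n -> Y -> Y -> K).
Hypothesis e_hom : forall y, e y \is (dgY y).-homog.
Hypothesis e_free : forall c : Y -> K, I (\sum_y c y *: e y) -> forall y, c y = 0.
Hypothesis e_span : forall p, exists c : Y -> K, I (p - \sum_y c y *: e y).
Hypothesis Mdeg : forall i a b, M i a b != 0 -> dgY b = (dgY a).+1.
Hypothesis XM : forall i a, I ('X_i * e a - \sum_b M i a b *: e b).

Let ID := @idealD _ _ _ homI.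
Let IM := @idealM _ _ _ homI.
Let IB := @idealB _ _ _ homI.
Let IZ := @idealZ _ _ _ homI.
Let Isum := @ideal_sum _ _ _ homI.

Let natK (k : nat) : (0 < k)%N -> k%:R != 0 :> K.
Proof. by move=> k0; have /pcharf0P -> := charK; rewrite -lt0n. Qed.

(** Both sides are coordinates of x_i x_k e_a modulo I, and the e_y are independent modulo I. *)
Lemma mult_matrix_comm i k a c : \sum_b M i a b * M k b c = \sum_b M k a b * M i b c.
Proof.
have h i' k' : I ('X_k' * ('X_i' * e a) - \sum_c (\sum_b M i' a b * M k' b c) *: e c).
  have -> : 'X_k' * ('X_i' * e a) - \sum_c (\sum_b M i' a b * M k' b c) *: e c =
     'X_k' * ('X_i' * e a - \sum_b M i' a b *: e b)
     + \sum_b M i' a b *: ('X_k' * e b - \sum_c M k' b c *: e c).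
    rewrite mulrBr -addrA; congr (_ + _).
    under [X in _ + X]eq_bigr do rewrite scalerBr.
    rewrite sumrB addrA mulr_sumr.
    under eq_bigr do rewrite scaler_suml.
    rewrite exchange_big /= [X in _ = X + _ - _](_ : _ = - \sum_b M i' a b *: ('X_k' * e b)).
      rewrite addNr add0r; congr (- _); apply: eq_bigr => b _.
      by rewrite scaler_sumr; apply: eq_bigr => c' _; rewrite scalerA.
    by congr (- _); apply: eq_bigr => b _; rewrite scalerAr.
  by apply: ID; [apply: IM | apply: Isum => b _; apply: IZ].
have := IB (h k i) (h i k).
rewrite (mulrCA 'X_i) opprB addrC addrA subrK => hh.
apply/eqP; rewrite -subr_eq0; apply/eqP.
apply: (e_free (c := fun c => \sum_b M i a b * M k b c - \sum_b M k a b * M i b c)).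
by under eq_bigr do rewrite scalerBl; rewrite sumrB.
Qed.

(** The operator x_i - M_i on S tensor A; the common cokernel of these operators is A as an
    S-module. *)
Definition shifted_mul i (w : Y -> S) (b : Y) : S := 'X_i * w b - \sum_a w a * (M i a b)%:MP.

Lemma eq_shifted_mul i w w' : w =1 w' -> shifted_mul i w =1 shifted_mul i w'.
Proof. by move=> h b; rewrite /shifted_mul h; congr (_ - _); apply: eq_bigr => a _; rewrite h. Qed.

Lemma shifted_mul_sum (T : Type) (r : seq T) (P : pred T) (s : T -> nat) (G : T -> Y -> S) i b :
  shifted_mul i (fun b => \sum_(t <- r | P t) (-1) ^+ s t * G t b) b =
  \sum_(t <- r | P t) (-1) ^+ s t * shifted_mul i (G t) b.
Proof.
rewrite /shifted_mul mulr_sumr; under [X in _ - X]eq_bigr do rewrite mulr_suml.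
rewrite exchange_big -sumrB; apply: eq_bigr => t _ /=.
rewrite mulrBr mulr_sumr mulrCA; congr (_ - _); apply: eq_bigr => a _; exact/esym/mulrA.
Qed.

Lemma shifted_mul_comm i k w b : shifted_mul i (shifted_mul k w) b = shifted_mul k (shifted_mul i w) b.
Proof.
have E i' k' : shifted_mul i' (shifted_mul k' w) b = 'X_i' * 'X_k' * w b
   - (\sum_a 'X_i' * (w a * (M k' a b)%:MP) + \sum_a 'X_k' * (w a * (M i' a b)%:MP))
   + \sum_a w a * (\sum_c M k' a c * M i' c b)%:MP.
  have -> : shifted_mul i' (shifted_mul k' w) b = 'X_i' * shifted_mul k' w b - (\sum_a 'X_k' * (w a * (M i' a b)%:MP)
      - \sum_a w a * (\sum_c M k' a c * M i' c b)%:MP).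
    congr (_ - _); rewrite /shifted_mul; under eq_bigr do rewrite mulrBl -mulrA.
    rewrite sumrB; congr (_ - _); under eq_bigr do rewrite mulr_suml.
    rewrite exchange_big; apply: eq_bigr => a _ /=.
    rewrite raddf_sum mulr_sumr; apply: eq_bigr => c _ /=.
    by rewrite mpolyCM mulrA.
  rewrite /shifted_mul mulrBr mulr_sumr; ring.
rewrite !E (mulrC 'X_i) [X in _ - X]addrC; congr (_ + _).
by apply: eq_bigr => a _; rewrite mult_matrix_comm.
Qed.

(* The Koszul differential of the commuting operators x_i - M_i on S tensor K^Y. *)
Definition kos_op (u : {set 'I_n} -> Y -> S) (J : {set 'I_n}) (b : Y) : S :=
  \sum_(i | i \notin J) (-1) ^+ kos_sign i J * shifted_mul i (u (i |: J)) b.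

Lemma eq_kos_op u u' J b : (forall J b, u J b = u' J b) -> kos_op u J b = kos_op u' J b.
Proof. by move=> h; apply: eq_bigr => i _; rewrite (@eq_shifted_mul _ _ (u' (i |: J))) // => ?. Qed.

(** Swapping the two added indices changes the sign because the operators commute, so the square is
    its own negative, and 2 is invertible. *)
Lemma kos_op_sq u J b : kos_op (kos_op u) J b = 0.
Proof.
pose T i k := (-1) ^+ (kos_sign i J + kos_sign k (i |: J)) * shifted_mul i (shifted_mul k (u (k |: (i |: J)))) b.
have E : kos_op (kos_op u) J b =
    \sum_(i | i \notin J) \sum_(k | (k \notin J) && (k != i)) T i k.
  apply: eq_bigr => i iJ; rewrite shifted_mul_sum mulr_sumr; apply: eq_big => [k|k _].
    by rewrite !inE negb_or andbC.
  by rewrite mulrA -exprD.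
have E2 : kos_op (kos_op u) J b = - kos_op (kos_op u) J b.
  rewrite {1}E; under eq_bigr do rewrite big_mkcondr.
  rewrite exchange_big /= E -sumrN; apply: eq_bigr => k kJ.
  rewrite -sumrN big_mkcondr; apply: eq_bigr => i iJ.
  rewrite eq_sym; case: ifP => // ki; rewrite /T.
  rewrite shifted_mul_comm setUCA (kos_signU1 k iJ) (kos_signU1 i kJ) -mulNr; congr (_ * _).
  rewrite !exprD.
  have : (-1) ^+ (i < k)%N = - (-1) ^+ (k < i)%N :> S.
    by move: ki; case: (ltngtP i k) => [||/val_inj ->]; rewrite ?eqxx // expr0 expr1 ?opprK.
  move: ((-1) ^+ (k < i)%N) ((-1) ^+ (i < k)%N) ((-1) ^+ kos_sign k J) ((-1) ^+ kos_sign i J).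
  move=> a b' x y ->; ring.
move/eqP: E2; rewrite -addr_eq0 -mulr2n -scaler_nat scaler_eq0 (negbTE (natK _)) // => /eqP.
exact.
Qed.

Lemma kos_opD u v J b : kos_op (fun J b => u J b + v J b) J b = kos_op u J b + kos_op v J b.
Proof.
rewrite -big_split; apply: eq_bigr => i _ /=; rewrite -mulrDr; congr (_ * _).
rewrite /shifted_mul mulrDr; under eq_bigr do rewrite mulrDl.
by rewrite big_split opprD addrACA.
Qed.

Lemma kos_opN u J b : kos_op (fun J b => - u J b) J b = - kos_op u J b.
Proof.
rewrite -sumrN; apply: eq_bigr => i _ /=; rewrite -mulrN; congr (_ * _).
rewrite /shifted_mul mulrN; under eq_bigr do rewrite mulNr.
by rewrite sumrN opprD.
Qed.

Lemma kos_op_aug u : I (\sum_b kos_op u set0 b * e b).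
Proof.
have -> : \sum_b kos_op u set0 b * e b =
  \sum_i (-1) ^+ kos_sign i set0 * \sum_a u (i |: set0) a * ('X_i * e a - \sum_b M i a b *: e b).
  rewrite /kos_op; under eq_bigr do rewrite mulr_suml.
  rewrite exchange_big /=; apply: eq_big => [i|i _]; first by rewrite inE.
  rewrite mulr_sumr.
  under [RHS]eq_bigr do rewrite mulrBr.
  under eq_bigr do rewrite /shifted_mul mulrBr mulrBl.
  rewrite sumrB; under [RHS]eq_bigr do rewrite mulrBr.
  rewrite [RHS]sumrB; congr (_ - _); first by apply: eq_bigr => a _; ring.
  under eq_bigr do rewrite mulr_sumr mulr_suml.
  rewrite exchange_big; apply: eq_bigr => a _ /=.
  rewrite !mulr_sumr; apply: eq_bigr => b _; rewrite -mul_mpolyC; ring.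
apply: Isum => i _; apply: IM; apply: Isum => a _; apply: IM; exact: XM.
Qed.

(* Induction on the polynomial degree d of u: the degree d part of u is a cycle
   for x_1, ..., x_n alone, hence, by the de Rham homotopy (beta = d/dx_i), equal
   to the top part of a boundary of something of degree d - 1. *)
Lemma kos_op_exact u : (forall J b, kos_op u J b = 0) -> I (\sum_b u set0 b * e b) ->
  exists w, forall J b, u J b = kos_op w J b.
Proof.
pose d := \max_J \max_b msize (u J b).
have : forall J b, deg_le d (u J b).
  move=> J b m dm; apply: deg_le_msize; apply: leq_ltn_trans dm.
  by apply: leq_trans (leq_bigmax J) ; apply: (leq_bigmax b).
move: d => d.
(* The constant matrices M_i do not raise the polynomial degree, so in degree d' + 1 only the x_i
   contribute. *)
have top d' (v : {set 'I_n} -> Y -> S) : (forall J b, deg_le d' (v J b)) -> (forall J b, kos_op v J b = 0) ->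
    forall J b, kos_diff (fun J => zpart d'%:Z (v J b)) J = 0.
  move=> hv v0 J b; have := congr1 (zpart d'.+1%:Z) (v0 J b); rewrite zpart0 => <-.
  rewrite zpart_sum; apply: eq_bigr => i _; rewrite zpartMsign; congr (_ * _).
  rewrite /shifted_mul zpartD zpartN zpartXM (@zpart_deg_le _ _ d' d'.+1) ?oppr0 ?addr0 //.
  by apply: deg_le_sum => a _; apply: deg_leMC.
(* On the component J of a cycle of degree d', contraction after the de Rham homotopy is
   multiplication by d' + #|J|: d' comes from Euler's identity, #|J| from differentiating the
   variables. *)
pose w1 d' (v : {set 'I_n} -> Y -> S) J b :=
  kos_htpy (fun i => mderiv i : {linear S -> S}) (fun J => (d' + #|J|)%:R^-1 *: zpart d'%:Z (v J b)) J.
have w1E d' (v : {set 'I_n} -> Y -> S) :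
    (forall J b, deg_le d' (v J b)) -> (forall J b, kos_op v J b = 0) ->
    forall (J : {set 'I_n}) (b : Y), (0 < d' + #|J|)%N ->
    kos_diff (fun J => w1 d' v J b) J = zpart d'%:Z (v J b).
  move=> hv v0 J b dJ.
  have := @kos_diff_htpy n K (fun i => mderiv i : {linear S -> S}) 1
    (fun J => (d' + #|J|)%:R^-1 *: zpart d'%:Z (v J b)) J.
  rewrite [X in _ + X]/kos_htpy big1 ?addr0 => [h|i _].
    rewrite h => [|i k p]; last first.
      rewrite scale1r /= mderivM addrC; congr (_ + _).
      rewrite mderivX mnm1E; case: eqVneq => [->|]; last by rewrite scale0r mul0r.
      rewrite (_ : U_(k) - U_(k) = 0)%MM ?mpolyX0 ?scale1r ?mul1r //.
      by apply/mnmP=> j; rewrite mnmBE mnm0E subnn.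
    rewrite scale1r (@euler_mderiv _ _ _ d'); last first.
      by apply/zhomog_dhomog/zhomogZ/zpart_homog.
    by rewrite -scaler_nat -scalerDl -natrD scalerA divff ?scale1r // natK.
  rewrite (_ : kos_diff _ _ = 0) ?raddf0 ?mulr0 //.
  rewrite -[RHS](scaler0 _ (d' + #|J :\ i|.+1)%:R^-1) -(top d' v hv v0 (J :\ i) b).
  rewrite /kos_diff scaler_sumr; apply: eq_bigr => k kJ.
  by rewrite cardsU1 kJ add1n -!mul_mpolyC; ring.
have kos_op0 J b : kos_op (fun _ _ => 0) J b = 0.
  by rewrite /kos_op big1 // => i _; rewrite /shifted_mul mulr0 big1 ?subr0 ?mulr0 // => a _; rewrite mul0r.
elim: d u => [|d IHd] u hu u0 au.
  (* Constant cycles are zero: for nonempty J the homotopy differentiates constants, and for empty J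
     the independence of the e_y modulo I applies. *)
  have uC J b : zpart 0%N%:Z (u J b) = u J b.
    by apply: zpart_id; apply/zhomogP=> m m0; apply: hu; rewrite lt0n.
  have uJ (J : {set 'I_n}) b : (0 < #|J|)%N -> u J b = 0.
    move=> J0; rewrite -uC -(w1E 0%N u hu u0 J b J0) /kos_diff big1 // => i _.
    rewrite /w1 /kos_htpy big1 ?mulr0 // => k _.
    rewrite uC (zhomog_const (p := u _ b)); last by rewrite -uC; apply: zpart_homog.
    by rewrite -mul_mpolyC -mpolyCM /= mderivC mulr0.
  have c0 b : (u set0 b)@_0%MM = 0.
    apply: (e_free (c := fun b => (u set0 b)@_0%MM)); move: au; congr I.
    apply: eq_bigr => a _; rewrite -mul_mpolyC -zhomog_const // -uC; exact: zpart_homog.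
  exists (fun _ _ => 0) => J b; rewrite kos_op0.
  have [->|] := eqVneq J set0; last by rewrite -card_gt0 => /uJ ->.
  by rewrite (zhomog_const (p := u _ b)) ?c0 ?mpolyC0 // -uC; apply: zpart_homog.
pose w := w1 d.+1 u.
have wdle J b : deg_le d (w J b).
  apply: deg_le_sum => i _; apply: deg_leMsign; apply: deg_le_mderiv.
  exact/zhomogZ/zpart_homog.
have kos_opE J b : kos_op w J b = zpart d.+1%:Z (u J b) -
    \sum_(i | i \notin J) (-1) ^+ kos_sign i J * \sum_a w (i |: J) a * (M i a b)%:MP.
  rewrite -(w1E d.+1 u hu u0 J b) ?addSn // /kos_diff -sumrB.
  by apply: eq_bigr => i _; rewrite -mulrBr.
have [J b|J b||w2 hw2] := IHd (fun J b => u J b + - kos_op w J b).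
- rewrite kos_opE opprB addrCA; apply: deg_leD; last exact: deg_le_zpart_sub.
  by apply: deg_le_sum => i _; apply: deg_leMsign; apply: deg_le_sum => a _; apply: deg_leMC.
- by rewrite kos_opD u0 kos_opN kos_op_sq subr0.
- under eq_bigr do rewrite mulrBl.
  by rewrite sumrB; apply: IB => //; apply: kos_op_aug.
exists (fun J b => w J b + w2 J b) => J b.
by rewrite kos_opD -hw2 addrC subrK.
Qed.

Definition kos_basis : finType := ({set 'I_n} * Y)%type.
Definition kos_hd (x : kos_basis) : nat := #|x.1|.
Definition kos_deg (x : kos_basis) : int := (#|x.1| + dgY x.2)%:Z.
(** At most one i passes the filter; the sum avoids having to extract it from the two sets. *)
Definition kos_mx (x y : kos_basis) : S :=
  \sum_(i | (i \notin y.1) && (x.1 == i |: y.1))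
    (-1) ^+ kos_sign i y.1 * (('X_i *+ (x.2 == y.2)) - (M i x.2 y.2)%:MP).
Definition kos_aug (x : kos_basis) : S := if x.1 == set0 then e x.2 else 0.

Lemma sum_kos_mx (v : kos_basis -> S) y :
  \sum_(x in [set: kos_basis]) v x * kos_mx x y = kos_op (fun J a => v (J, a)) y.1 y.2.
Proof.
case: y => J b /=; rewrite (eq_bigl xpredT) => [|x]; last by rewrite inE.
rewrite (eq_bigr (fun x => v (x.1, x.2) * kos_mx (x.1, x.2) (J, b))) => [|[]//].
rewrite -(pair_bigA _ (fun J' a => v (J', a) * kos_mx (J', a) (J, b))) /= exchange_big /=.
have E a : \sum_J' v (J', a) * kos_mx (J', a) (J, b) = \sum_(i | i \notin J)
    v (i |: J, a) * ((-1) ^+ kos_sign i J * ('X_i *+ (a == b) - (M i a b)%:MP)).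
  rewrite /kos_mx /=; under eq_bigr do rewrite mulr_sumr.
  rewrite (exchange_big_dep (fun i => i \notin J)) /=; last by move=> ? ? _ /andP[].
  by apply: eq_bigr => i iJ; rewrite (big_pred1 (i |: J)) // => J' /=; rewrite iJ.
rewrite (eq_bigr _ (fun a _ => E a)) exchange_big /=; apply: eq_bigr => i iJ.
rewrite /shifted_mul mulrBr mulr_sumr.
under eq_bigr do rewrite mulrBr mulrBr.
rewrite sumrB; congr (_ - _); last by apply: eq_bigr => a _; ring.
rewrite (bigD1 b) //= eqxx big1 ?addr0 => [|a /negbTE ->]; last by rewrite mulr0n !mulr0.
by rewrite mulr1n; ring.
Qed.

Lemma sum_kos_aug (v : kos_basis -> S) :
  \sum_(x in [set: kos_basis]) v x * kos_aug x = \sum_b v (set0, b) * e b.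
Proof.
rewrite (eq_bigl xpredT) => [|x]; last by rewrite inE.
rewrite (eq_bigr (fun x => v (x.1, x.2) * kos_aug (x.1, x.2))) => [|[]//].
rewrite -(pair_bigA _ (fun J a => v (J, a) * kos_aug (J, a))) (bigD1 set0) //=.
rewrite [X in _ + X]big1 ?addr0 => [|J J0]; last first.
  by rewrite big1 // => b _; rewrite /kos_aug /= (negbTE J0) mulr0.
by apply: eq_bigr => b _; rewrite /kos_aug eqxx.
Qed.

Lemma kos_mx_hom x y : zhomog (kos_deg x - kos_deg y) (kos_mx x y).
Proof.
apply: zhomog_sum => i /andP[iJ /eqP E]; rewrite -signr_odd mulr_sign.
suff h : zhomog (kos_deg x - kos_deg y) ('X_i *+ (x.2 == y.2) - (M i x.2 y.2)%:MP).
  by case: ifP => // _; apply: zhomogN.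
have dE : kos_deg x - kos_deg y = 1 + (dgY x.2)%:Z - (dgY y.2)%:Z.
  rewrite /kos_deg E cardsU1 iJ -addnA !PoszD [X in X + _ - _](_ : _ = 1) //; ring.
apply: zhomogB.
  case: (x.2 =P y.2) => [e2|_]; last exact: zhomog0.
  by rewrite dE e2 addrK; apply: zhomogX.
have [->|/Mdeg d2] := eqVneq (M i x.2 y.2) 0; first by rewrite mpolyC0; apply: zhomog0.
by rewrite dE d2 -addn1 PoszD [1 + _]addrC subrr; apply: zhomogC.
Qed.

Lemma koszul_res : based_res I kos_hd kos_deg [set: kos_basis] kos_mx kos_aug.
Proof.
(* The rows of the matrix are the images of unit vectors, which turns the matrix identities into the
   operator identities above. *)
have kos_mxE x y : kos_mx x y = kos_op (fun J a => (x == (J, a))%:R) y.1 y.2.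
  rewrite -(sum_kos_mx (fun z => (x == z)%:R)) (bigD1 x) ?inE //= eqxx mul1r big1 ?addr0 // => z.
  by move=> /andP[_ /negbTE]; rewrite eq_sym => ->; rewrite mul0r.
split.
- move=> x y hxy; rewrite /kos_mx big1 // => i /andP[iJ /eqP E].
  by rewrite /kos_hd E cardsU1 iJ eqxx in hxy.
- by move=> x; rewrite /kos_hd /kos_aug cards_eq0 => /negbTE ->.
- exact: kos_mx_hom.
- move=> x; rewrite /kos_aug /kos_deg; case: eqP => [->|_]; last exact: zhomog0.
  by rewrite cards0 add0n; apply/zhomog_dhomog.
- move=> x z _ _; rewrite sum_kos_mx -[RHS](kos_op_sq (fun J a => (x == (J, a))%:R) z.1 z.2).
  by apply: eq_kos_op => J b; rewrite kos_mxE.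
- move=> x _; rewrite sum_kos_aug; under eq_bigr do rewrite kos_mxE /=.
  exact: kos_op_aug.
- move=> p; have [c hc] := e_span p; exists (fun x => (c x.2)%:MP); rewrite sum_kos_aug.
  by under eq_bigr do rewrite mul_mpolyC.
move=> v hv; rewrite sum_kos_aug => av.
have [|w hw] := @kos_op_exact (fun J b => v (J, b)) _ av.
  by move=> J b; rewrite -(sum_kos_mx v (J, b)) hv ?inE.
by exists (fun x => w x.1 x.2) => -[J b] _; rewrite sum_kos_mx /= hw.
Qed.

End KoszulResolution.

(** * Betti numbers as Koszul homology *)

Section BasedBetti.
Variables (n : nat) (K : fieldType) (I : {mpoly K[n]} -> Prop).
Hypothesis homI : is_homog_ideal I.
Local Notation S := {mpoly K[n]}.
Variables (X : finType) (hd : X -> nat) (dg : X -> int).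
Variables (D : X -> X -> S) (aug : X -> S).
Hypothesis res : based_res I hd dg [set: X] D aug.
Let G := gf_of hd dg [set: X] D aug.
Let D0 x y : K := (D x y)@_0%MM.

Lemma coef0_deg x y : D0 x y != 0 -> hd x = (hd y).+1 /\ dg x = dg y.
Proof.
move=> h; split; last by apply: subr0_eq; apply: zhomog_coef0 h; apply: br_hom res _ _.
by apply/eqP; apply: contraNT h => /(br_lev res) e; rewrite /D0 e mcoeff0.
Qed.

Definition bideg_idx i j := [set k : 'I_(gf_rank G i) | gf_deg k == j].

Definition bideg_elt i j (a : 'I_(#|bideg_idx i j|)) : X := enum_val (enum_val a).

Lemma bideg_eltP i j (a : 'I_(#|bideg_idx i j|)) : hd (bideg_elt a) = i /\ dg (bideg_elt a) = j.
Proof.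
split; first by have := enum_valP (enum_val a); rewrite !inE => /eqP.
by have := enum_valP a; rewrite inE => /eqP.
Qed.

Lemma bideg_elt_inj i j : injective (@bideg_elt i j).
Proof. by move=> a b /enum_val_inj/enum_val_inj. Qed.

Lemma sum_bideg_elt (V : zmodType) i j (f : X -> V) :
  (forall x, ~~ ((hd x == i) && (dg x == j)) -> f x = 0) ->
  \sum_x f x = \sum_(a < #|bideg_idx i j|) f (bideg_elt a).
Proof.
move=> h; rewrite (eq_bigl (fun x => x \in [set: X])) => [|x]; last by rewrite inE.
rewrite (@sum_lvl _ hd _ i) => [|x hx]; last by apply: h; rewrite (negbTE hx).
rewrite /bideg_elt -(big_enum_val (fun k => f (enum_val k))) /=.
rewrite [LHS](bigID (mem (bideg_idx i j))) /= [X in _ + X]big1 ?addr0 // => k.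
by rewrite inE /= => hk; apply: h; rewrite negb_and hk orbT.
Qed.

Lemma gf_betti_based i j : gf_betti G i j = #|[set x | (hd x == i) && (dg x == j)]|.
Proof.
rewrite -sum1_card (_ : \sum_(x in _) 1 = \sum_x (((hd x == i) && (dg x == j)) : nat))%N; last first.
  by rewrite big_mkcond; apply: eq_bigr => x _; rewrite inE; case: (_ && _).
apply/eqP; rewrite -eqz_nat (big_morph Posz PoszD (erefl _)) (@sum_bideg_elt _ i j) => [|x /negbTE -> //].
rewrite (eq_bigr (fun _ => 1)) => [|a _]; last by have [-> ->] := bideg_eltP a; rewrite !eqxx.
by rewrite sumr_const card_ord natz.
Qed.

(** The criterion [betti_vanish] in terms of functions on X, free of the nested enumerations by
    level and by degree. *)
Lemma based_betti_vanish F i j :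
  minimal_graded_free_resolution I F ->
  (forall z : X -> K, (forall x, z x != 0 -> hd x = i /\ dg x = j) ->
     (forall y, \sum_x z x * D0 x y = 0) -> exists w : X -> K, forall y, z y = \sum_x w x * D0 x y) ->
  gf_betti F i j = 0%N.
Proof.
move=> mF hz; apply: (betti_vanish homI mF (gf_of_graded res) (gf_of_resolves homI res)) => z cz.
pose zf x : K := \sum_(a < #|bideg_idx i j|) z 0 a *+ (bideg_elt a == x).
have zfE a : zf (bideg_elt a) = z 0 a.
  rewrite /zf (bigD1 a) //= eqxx big1 ?addr0 // => b ba.
  by rewrite (inj_eq (@bideg_elt_inj i j)) (negbTE ba).
have zf0 x : ~~ ((hd x == i) && (dg x == j)) -> zf x = 0.
  move=> hx; rewrite /zf big1 // => a _; have [e|] := eqVneq (bideg_elt a) x => //.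
  by move: hx; rewrite -e; have [-> ->] := bideg_eltP a; rewrite !eqxx.
have strand_diffE i' (a : 'I_(#|bideg_idx i'.+1 j|)) (b : 'I_(#|bideg_idx i' j|)) :
    strand_diff G i' j a b = D0 (bideg_elt a) (bideg_elt b) by rewrite !mxE.
have [x zx|y|w hw] := hz zf.
- have : (hd x == i) && (dg x == j) by apply: contraNT zx => /zf0 ->.
  by case/andP=> /eqP -> /eqP ->.
- have [/andP[hy /eqP dy]|ny] := boolP (((hd y).+1 == i) && (dg y == j)); last first.
    rewrite big1 // => x _; have [->|/coef0_deg[hx dx]] := eqVneq (D0 x y) 0; first by rewrite mulr0.
    by rewrite zf0 ?mul0r // hx dx.
  case: i hz z cz zf zfE zf0 hy => // i hz z cz zf zfE zf0 /eqP [hy].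
  rewrite (@sum_bideg_elt _ i.+1 j) => [|x hx]; last by rewrite zf0 ?mul0r.
  have yl : y \in lvl hd [set: X] i by rewrite !inE hy eqxx.
  have kb : enum_rank_in yl y \in bideg_idx i j by rewrite inE /= enum_rankK_in ?dy ?eqxx.
  move/rowP/(_ (enum_rank_in kb (enum_rank_in yl y))): cz; rewrite [RHS]mxE mxE => {}cz.
  rewrite -[RHS]cz; apply: eq_bigr => a _; rewrite zfE strand_diffE; congr (_ * D0 _ _).
  by rewrite /bideg_elt enum_rankK_in // enum_rankK_in.
apply/submxP; exists (\row_a w (bideg_elt a)); apply/rowP=> b; rewrite -zfE hw mxE.
rewrite (@sum_bideg_elt _ i.+1 j) => [|x hx]; first by apply: eq_bigr => a _; rewrite mxE strand_diffE.
have [->|/coef0_deg[h1 h2]] := eqVneq (D0 x (bideg_elt b)) 0; first by rewrite mulr0.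
by move: hx; rewrite h1 h2; have [-> ->] := bideg_eltP b; rewrite !eqxx.
Qed.

End BasedBetti.

(* H_i(x_1, ..., x_n; S/I) vanishes in internal degree i + d. *)
Definition koszul_acyclic (n : nat) (K : fieldType) (I : {mpoly K[n]} -> Prop) (i d : nat) : Prop :=
  forall p : {set 'I_n} -> {mpoly K[n]},
    (forall J, p J \is d.-homog) -> (forall J : {set 'I_n}, #|J| != i -> p J = 0) ->
    (forall J, I (kos_diff p J)) -> exists q, forall J, I (p J - kos_diff q J).

Section KoszulBetti.
Variables (n : nat) (K : fieldType) (I : {mpoly K[n]} -> Prop).
Hypothesis charK : [pchar K] =i pred0.
Hypothesis homI : is_homog_ideal I.
Local Notation S := {mpoly K[n]}.
Variables (Y : finType) (e : Y -> S) (dgY : Y -> nat).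
Hypothesis e_hom : forall y, e y \is (dgY y).-homog.
Hypothesis e_free : forall c : Y -> K, I (\sum_y c y *: e y) -> forall y, c y = 0.
Hypothesis e_span : forall p, exists c : Y -> K, I (p - \sum_y c y *: e y).

Let ID := @idealD _ _ _ homI.
Let IM := @idealM _ _ _ homI.
Let IB := @idealB _ _ _ homI.
Let IZ := @idealZ _ _ _ homI.
Let Isum := @ideal_sum _ _ _ homI.

Lemma mult_matrix : exists M : 'I_n -> Y -> Y -> K,
  (forall i a b, M i a b != 0 -> dgY b = (dgY a).+1) /\
  (forall i a, I ('X_i * e a - \sum_b M i a b *: e b)).
Proof.
have /fin_all_exists [c hc] : forall ia : 'I_n * Y, exists c : Y -> K,
    I ('X_(ia.1) * e ia.2 - \sum_y c y *: e y) by move=> ia; apply: e_span.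
(* Coefficients outside the degree of x_i e_a are dropped; the congruence survives because I is
   homogeneous. *)
exists (fun i a b => if dgY b == (dgY a).+1 then c (i, a) b else 0); split=> [i a b|i a].
  by case: ifP => [/eqP//|]; rewrite eqxx.
have hia : I ('X_i * e a - \sum_y c (i, a) y *: e y) by apply: hc (i, a).
have := homog_ideal_zpart homI (dgY a).+1%:Z hia.
rewrite zpartD zpartN (zpart_id (p := 'X_i * e a)); last first.
  by rewrite -add1n PoszD; apply: zhomogM; [apply: zhomogX | apply/zhomog_dhomog].
congr (I (_ - _)); rewrite zpart_sum; apply: eq_bigr => b _.
case: eqVneq => [d|d].
  by rewrite zpart_id // -d; apply/zhomogZ/zhomog_dhomog.
rewrite scale0r; apply/mpolyP=> m; rewrite mcoeff_zpart mcoeff0; case: eqP => // -[md].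
by rewrite mcoeffZ (dhomog_nemf_coeff (e_hom b)) ?mulr0 //= md eq_sym.
Qed.

(* rho i j is the rank of the i-th differential of the Koszul complex of S/I in
   internal degree j. *)
Lemma koszul_betti : exists2 rho : nat -> int -> nat, forall j, rho 0%N j = 0%N &
  (exists F, minimal_graded_free_resolution I F) /\
  forall F, minimal_graded_free_resolution I F ->
    (forall i j, (gf_betti F i j + rho i.+1 j + rho i j =
       #|[set x : {set 'I_n} * Y | (#|x.1| == i) && ((#|x.1| + dgY x.2)%:Z == j)%R]|)%N) /\
    (forall i a, koszul_acyclic I i a -> gf_betti F i (i + a)%:Z = 0%N).
Proof.
have [M [Mdeg XM]] := mult_matrix.
have res := koszul_res charK homI e_hom e_free e_span Mdeg XM.
exists (strand_rank (gf_of (@kos_hd n Y) (kos_deg dgY) [set: kos_basis n Y] (kos_mx M) (kos_aug e))) => //.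
split; first exact: (based_res_exists_minimal homI res).
move=> F mF; split=> [i j|i a ac].
  by rewrite (betti_rank homI mF (gf_of_graded res) (gf_of_resolves homI res)) gf_betti_based.
apply: (based_betti_vanish homI res mF) => z hz cz.
(* At x = 0 the operator x_k - M_k becomes - M_k. This sign between G tensor K and the Koszul
   complex of A is the reason for the witness - w below. *)
have D0E (v : kos_basis n Y -> K) J b : \sum_x v x * (kos_mx M x (J, b))@_0%MM =
    - \sum_(k | k \notin J) (-1) ^+ kos_sign k J * \sum_a v (k |: J, a) * M k a b.
  transitivity ((\sum_(x in [set: kos_basis n Y]) (v x)%:MP * kos_mx M x (J, b))@_0%MM).
    rewrite raddf_sum /=; apply: eq_big => [x|x _]; first by rewrite inE.
    by rewrite mcoeffCM.
  rewrite sum_kos_mx /kos_op raddf_sum /= -sumrN; apply: eq_bigr => k _.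
  rewrite [LHS](rmorphM (mcoeff 0%MM)) rmorph_sign /= -mulrN; congr (_ * _).
  rewrite /shifted_mul mcoeffB [X in X - _](rmorphM (mcoeff 0%MM)) /= mcoeffX.
  rewrite (_ : (U_(k)%MM == 0%MM) = false); last by rewrite -mdeg_eq0 mdeg1.
  rewrite mul0r sub0r raddf_sum /=; congr (- _); apply: eq_bigr => c _.
  by rewrite mcoeffCM mcoeffC eqxx mulr1.
have zD (v : kos_basis n Y -> K) J : I (kos_diff (fun J => \sum_y v (J, y) *: e y) J +
    \sum_b (\sum_x v x * (kos_mx M x (J, b))@_0%MM) *: e b).
  have -> : \sum_b (\sum_x v x * (kos_mx M x (J, b))@_0%MM) *: e b =
     - \sum_(k | k \notin J) (-1) ^+ kos_sign k J * \sum_a v (k |: J, a) *: \sum_b M k a b *: e b.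
    under eq_bigr do rewrite D0E scaleNr scaler_suml.
    rewrite sumrN exchange_big /=; congr (- _); apply: eq_bigr => k _.
    rewrite mulr_sumr; under eq_bigr do rewrite -scalerA scaler_suml scaler_sumr.
    rewrite exchange_big; apply: eq_bigr => c _ /=.
    rewrite scaler_sumr mulr_sumr; apply: eq_bigr => b _.
    rewrite -!mul_mpolyC rmorph_sign mpolyCM; ring.
  rewrite -sumrB; apply: Isum => k _; rewrite -mulrBr; apply: IM.
  rewrite mulr_sumr -sumrB; apply: Isum => c _.
  by rewrite -scalerAr -scalerBr; apply: IZ.
have [J|J Ji|J|q hq] := ac (fun J => \sum_y z (J, y) *: e y).
- rewrite rpred_sum // => y _; have [->|/hz[/= h1 h2]] := eqVneq (z (J, y)) 0.
    by rewrite scale0r rpred0.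
  apply: rpredZ; move: h2; rewrite /kos_deg /= -h1 => -[] /eqP; rewrite eqn_add2l => /eqP <-.
  exact: e_hom.
- rewrite big1 // => y _; have [->|/hz[/= h1 _]] := eqVneq (z (J, y)) 0; first by rewrite scale0r.
  by rewrite -h1 eqxx in Ji.
- have := zD z J; rewrite [X in _ + X]big1 ?addr0 // => b _; by rewrite cz scale0r.
have /fin_all_exists [w hw] : forall J, exists c : Y -> K, I (q J - \sum_y c y *: e y).
  by move=> J; apply: e_span.
exists (fun x => - w x.1 x.2) => -[J b].
apply/eqP; rewrite -subr_eq0; apply/eqP.
apply: (e_free (c := fun b => z (J, b) - \sum_x - w x.1 x.2 * (kos_mx M x (J, b))@_0%MM)).
have h1 := zD (fun x => - w x.1 x.2) J.
have h2 : I (kos_diff (fun J => \sum_y - w J y *: e y) J + kos_diff q J).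
  rewrite -kos_diffD /kos_diff; apply: Isum => k _; do 2!apply: IM.
  rewrite addrC; under [X in _ + X]eq_bigr do rewrite scaleNr.
  by rewrite sumrN; apply: hw.
have := ID (hq J) (IB h2 h1); congr I.
under [RHS]eq_bigr do rewrite scalerBl.
rewrite [RHS]sumrB; ring.
Qed.

End KoszulBetti.

Lemma card_koszul_basis n (Y : finType) (dgY : Y -> nat) (i a : nat) :
  #|[set x : {set 'I_n} * Y | (#|x.1| == i) && ((#|x.1| + dgY x.2)%:Z == (i + a)%:Z)%R]| =
  ('C(n, i) * #|[set y | dgY y == a]|)%N.
Proof.
have <- : #|[set J : {set 'I_n} | #|J| == i]| = 'C(n, i) by rewrite card_draws card_ord.
rewrite -cardsX; apply: eq_card => -[J y]; rewrite !inE /=.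
by case: eqP => //= ->; rewrite eqz_nat eqn_add2l.
Qed.

Lemma card_koszul_basis0 n (Y : finType) (dgY : Y -> nat) (i : nat) (j : int) :
  (forall a : nat, j <> (i + a)%:Z) ->
  #|[set x : {set 'I_n} * Y | (#|x.1| == i) && ((#|x.1| + dgY x.2)%:Z == j)%R]| = 0%N.
Proof.
move=> h; apply: eq_card0 => -[J y]; rewrite !inE /=.
by case: eqP => //= ->; apply/negP=> /eqP /esym /h.
Qed.

(** * Multiplication by linear forms *)

Section Avoidance.
Variables (T : finType) (q c : nat).

Definition update (g : {ffun T -> 'I_q.+1}) tau t : {ffun T -> 'I_q.+1} :=
  [ffun s => if s == tau then t else g s].

(* Each B tau covers at most a fraction c / (q + 1) of the grid. *)
Lemma avoidance (B : T -> pred {ffun T -> 'I_q.+1}) :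
  (forall tau g, #|[set t | B tau (update g tau t)]| <= c)%N -> (c * #|T| < q.+1)%N ->
  exists g, forall tau, ~~ B tau g.
Proof.
move=> hB hq.
have q0 : (0 < q.+1)%N by [].
pose N := #|{ffun T -> 'I_q.+1}|.
have N0 : (0 < N)%N by rewrite /N card_ffun card_ord expn_gt0 q0.
have cnt tau : (q.+1 * \sum_g B tau g <= c * N)%N.
  (* Translating the coordinate tau, with ['I_q.+1] read as the integers modulo q + 1, permutes the
     grid; summing over all q + 1 translations gives the identity. *)
  have -> : (q.+1 * \sum_g B tau g = \sum_g \sum_t B tau (update g tau t))%N.
    have sh (t : 'I_q.+1) : injective (fun g : {ffun T -> 'I_q.+1} => update g tau (g tau + t)).
      move=> g g' /ffunP e; apply/ffunP=> s; have := e s; have := e tau.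
      by rewrite !ffunE eqxx; case: eqP => [->|_ _ //] /addIr.
    transitivity (\sum_(t : 'I_q.+1) \sum_g B tau (update g tau (g tau + t)%R))%N.
      rewrite [RHS](eq_bigr (fun _ => \sum_g B tau g)%N) => [|t _]; first by rewrite big_const_ord iter_addn_0 mulnC.
      by rewrite [RHS](reindex_inj (sh t)).
    rewrite exchange_big; apply: eq_bigr => g _.
    by rewrite [RHS](reindex_inj (addrI (g tau))).
  rewrite mulnC -sum_nat_const; apply: leq_sum => g _.
  apply: leq_trans (hB tau g); rewrite -sum1_card [X in (_ <= X)%N]big_mkcond.
  by apply: leq_sum => t _; rewrite inE; case: (B _ _).
have tot : (\sum_g \sum_tau B tau g < N)%N.
  rewrite exchange_big /= -(ltn_pmul2l q0) big_distrr /=.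
  apply: (@leq_ltn_trans (\sum_(tau : T) c * N)%N); first exact: leq_sum.
  by rewrite sum_nat_const mulnA (mulnC #|T|) ltn_pmul2r.
suff /existsP[g /forallP h] : [exists g, [forall tau, ~~ B tau g]] by exists g.
apply: contraLR tot; rewrite negb_exists -leqNgt => /forallP h.
rewrite /N -sum1_card; apply: leq_sum => g _.
have := h g; rewrite negb_forall => /existsP[tau]; rewrite negbK => Bt.
by rewrite (bigD1 tau) //= Bt.
Qed.
End Avoidance.

(** * Bijectivity of multiplication by a linear form *)

Section MultiplicationByForms.
Variables (n : nat) (K : fieldType) (I : {mpoly K[n]} -> Prop).
Hypothesis charK : [pchar K] =i pred0.
Hypothesis homI : is_homog_ideal I.
Local Notation S := {mpoly K[n]}.

Let I0 := ideal0 homI.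
Let ID := @idealD _ _ _ homI.
Let IM := @idealM _ _ _ homI.
Let IN := @idealN _ _ _ homI.
Let IB := @idealB _ _ _ homI.
Let IZ := @idealZ _ _ _ homI.
Let Isum := @ideal_sum _ _ _ homI.

Lemma lincomb_mod r s (u : 'rV[K]_r) (E : 'M[K]_(r, s)) (f : 'I_r -> S) (g : 'I_s -> S) :
  (forall k, I (f k - \sum_l E k l *: g l)) ->
  I (\sum_k u 0 k *: f k - \sum_l (u *m E) 0 l *: g l).
Proof.
move=> h; have -> : \sum_l (u *m E) 0 l *: g l = \sum_k u 0 k *: \sum_l E k l *: g l.
  under eq_bigr do rewrite mxE scaler_suml.
  rewrite exchange_big; apply: eq_bigr => k _ /=.
  by rewrite scaler_sumr; apply: eq_bigr => l _; rewrite scalerA.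
by rewrite -sumrB; apply: Isum => k _; rewrite -scalerBr; apply: IZ.
Qed.

Lemma homog_lincomb d r (e : 'I_r -> S) (u : 'I_r -> K) :
  (forall k, e k \is d.-homog) -> \sum_k u k *: e k \is d.-homog.
Proof. by move=> h; apply: rpred_sum => k _; apply: rpredZ. Qed.

Section Bijectivity.
Variables (d r : nat) (l : S).
Hypothesis hl : l \is 1.-homog.
Hypothesis dim1 : has_dim_mod (fun p => p \is d.-homog) I r.
Hypothesis dim2 : has_dim_mod (fun p => p \is d.+1.-homog) I r.

Lemma mul_matrix : exists (e e' : 'I_r -> S) (E : 'M[K]_r),
  [/\ [/\ (forall k, e k \is d.-homog), (forall k, e' k \is d.+1.-homog) &
        (forall u : 'rV[K]_r, I (\sum_k u 0 k *: e k) -> u = 0)],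
      (forall u : 'rV[K]_r, I (\sum_k u 0 k *: e' k) -> u = 0),
      (forall p, p \is d.-homog -> exists u : 'rV[K]_r, I (p - \sum_k u 0 k *: e k)),
      (forall p, p \is d.+1.-homog -> exists u : 'rV[K]_r, I (p - \sum_k u 0 k *: e' k)) &
      forall u : 'rV[K]_r, I (l * (\sum_k u 0 k *: e k) - \sum_m (u *m E) 0 m *: e' m)].
Proof.
have [e [he fe se]] := dim1; have [e' [he' fe' se']] := dim2.
have /fin_all_exists [E hE] : forall k, exists c : 'I_r -> K, I (l * e k - \sum_m c m *: e' m).
  by move=> k; apply: se'; rewrite -add1n; apply: dhomogM.
exists e, e', (\matrix_(k, m) E k m); split=> //.
- by split=> // u /fe hu; apply/rowP=> k; rewrite hu mxE.
- by move=> u /fe' hu; apply/rowP=> k; rewrite hu mxE.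
- move=> p /se[c hc]; exists (\row_k c k); move: hc; congr (I (_ - _)).
  by apply: eq_bigr => k _; rewrite mxE.
- move=> p /se'[c hc]; exists (\row_k c k); move: hc; congr (I (_ - _)).
  by apply: eq_bigr => k _; rewrite mxE.
move=> u; have := @lincomb_mod r r u (\matrix_(k, m) E k m) (fun k => l * e k) e'.
rewrite mulr_sumr => h; under eq_bigr do rewrite -scalerAr.
apply: h => k; move: (hE k); congr (I (_ - _)).
by apply: eq_bigr => m _; rewrite mxE.
Qed.

(** Source and target have the same dimension r, so the matrix of multiplication by l is square. *)
Lemma mul_inj_surj : (forall p, p \is d.-homog -> I (l * p) -> I p) ->
  forall q, q \is d.+1.-homog -> exists2 p, p \is d.-homog & I (q - l * p).
Proof.
move=> inj q hq; have [e [e' [E [[he he' fe] fe' se se' hE]]]] := mul_matrix.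
have Efree : row_free E.
  rewrite -kermx_eq0; apply/rowV0P=> v /sub_kermxP vE.
  apply: fe; apply: inj; first exact: homog_lincomb.
  apply: (ideal_eqmod homI (hE v)); rewrite vE big1 // => m _; by rewrite mxE scale0r.
have [u hu] := se' q hq.
exists (\sum_k (u *m pinvmx E) 0 k *: e k); first exact: homog_lincomb.
have := IB hu (hE (u *m pinvmx E)).
rewrite mulmxKpV; last by apply: submx_full; rewrite row_full_unit -row_free_unit.
by congr I; ring.
Qed.

Lemma mul_surj_inj :
  (forall q, q \is d.+1.-homog -> exists2 p, p \is d.-homog & I (q - l * p)) ->
  forall p, p \is d.-homog -> I (l * p) -> I p.
Proof.
move=> surj p hp hlp; have [e [e' [E [[he he' fe] fe' se se' hE]]]] := mul_matrix.
have /fin_all_exists [U hU] : forall k, exists u : 'rV[K]_r, I (e' k - \sum_m (u *m E) 0 m *: e' m).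
  move=> k; have [p' hp' h1] := surj _ (he' k); have [u h2] := se _ hp'.
  exists u; have := ID (ID h1 (IM l h2)) (hE u); congr I; ring.
have UE : (\matrix_k U k) *m E = 1%:M.
  apply/row_matrixP=> k; rewrite row_mul rowK row1; apply/eqP; rewrite -subr_eq0 -oppr_eq0 opprB; apply/eqP.
  apply: fe'; move: (hU k); congr I; under [RHS]eq_bigr do rewrite !mxE scalerBl.
  rewrite sumrB; congr (_ - _); last by apply: eq_bigr => m _; rewrite mxE.
  rewrite (bigD1 k) //= eqxx scale1r big1 ?addr0 // => m /negbTE ->; by rewrite scale0r.
have [u hu] := se p hp.
have uE : u *m E = 0.
  apply: fe'; have := IB (IB hlp (IM l hu)) (hE u); congr I; ring.
apply: (ideal_eqmod homI hu); rewrite (_ : u = 0) ?big1 // => [k _|]; first by rewrite mxE scale0r.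
by rewrite -[u]mulmx1 -(mulmx1C UE) mulmxA uE mul0mx.
Qed.

End Bijectivity.

Lemma dhomog_mderiv d (p : S) i : p \is d.+1.-homog -> p^`M(i) \is d.-homog.
Proof.
move=> /zhomog_dhomog/zhomogP hp; apply/zhomog_dhomog/zhomogP=> m md.
by rewrite mcoeff_mderiv hp ?mul0rn // mdegD mdeg1 addn1 eqz_nat eqSS -eqz_nat.
Qed.

Lemma homog_split d (p : S) : p \is d.+1.-homog ->
  exists2 u : 'I_n -> S, forall i, u i \is d.-homog & p = \sum_i 'X_i * u i.
Proof.
move=> hp; exists (fun i => d.+1%:R^-1 *: p^`M(i)) => [i|].
  by apply: rpredZ; apply: dhomog_mderiv.
under eq_bigr do rewrite -scalerAr.
rewrite -scaler_sumr (euler_mderiv hp) scalerA mulVf ?scale1r //.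
by have /pcharf0P -> := charK.
Qed.

(** In q = x_1 u_1 + ... + x_n u_n each u_i is a multiple of l modulo I, hence so is q. *)
Lemma surj_succ d (l : S) :
  (forall q, q \is d.+1.-homog -> exists2 p, p \is d.-homog & I (q - l * p)) ->
  forall q, q \is d.+2.-homog -> exists2 p, p \is d.+1.-homog & I (q - l * p).
Proof.
move=> h q /homog_split[u hu ->].
have /fin_all_exists [v hv] : forall i, exists p, p \is d.-homog /\ I (u i - l * p).
  by move=> i; have [p] := h _ (hu i); exists p.
exists (\sum_i 'X_i * v i).
  by apply: rpred_sum => i _; rewrite -add1n; apply: dhomogM; [rewrite dhomogX /= mdeg1 | case: (hv i)].
rewrite mulr_sumr -sumrB; apply: Isum => i _.
by rewrite mulrCA -mulrBr; apply: IM; case: (hv i).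
Qed.

(* A linear form l is null-homotopic on the Koszul complex, so the homology dies
   wherever l is bijective. *)
Lemma koszul_acyclic_bij d (lam : 'I_n -> K) i :
  (forall q, q \is d.+1.-homog -> exists2 p, p \is d.-homog & I (q - (\sum_k lam k *: 'X_k) * p)) ->
  (forall p, p \is d.+1.-homog -> I ((\sum_k lam k *: 'X_k) * p) -> I p) ->
  koszul_acyclic I i d.+1.
Proof.
set l := \sum_k _ => surj inj p hp _ cp.
have /fin_all_exists [q hq] : forall J, exists q, q \is d.-homog /\ I (p J - l * q).
  by move=> J; have [q] := surj _ (hp J); exists q.
have kdq J : I (kos_diff q J).
  apply: inj.
    apply: rpred_sum => k _; rewrite -signr_odd mulr_sign.
    have h : 'X_k * q (k |: J) \is d.+1.-homog.
      by rewrite -add1n; apply: dhomogM; [rewrite dhomogX /= mdeg1 | case: (hq (k |: J))].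
    by case: ifP => // _; rewrite rpredN.
  rewrite -kos_diffMl; apply: (ideal_eqmod homI _ (cp J)); rewrite -opprB; apply: IN.
  rewrite -sumrB; apply: Isum => k _; rewrite -mulrBr -mulrBr; do 2!apply: IM.
  by case: (hq (k |: J)).
exists (kos_htpy (fun k => GRing.scale (lam k) : {linear S -> S}) q) => J.
have hb k k' u : (GRing.scale (lam k') : {linear S -> S}) ('X_k * u) =
    'X_k * (GRing.scale (lam k') : {linear S -> S}) u + (0 *: u) *+ (k == k').
  by rewrite scale0r mul0rn addr0 /= scalerAr.
have := @kos_diff_htpy n K (fun k => GRing.scale (lam k) : {linear S -> S}) 0 q J hb.
rewrite scale0r mul0rn addr0 => E.
have kos_htpyI : I (kos_htpy (fun k => GRing.scale (lam k) : {linear S -> S}) (kos_diff q) J).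
  by apply: Isum => k _; apply: IM; apply: IZ.
have -> : kos_diff (kos_htpy (fun k => GRing.scale (lam k) : {linear S -> S}) q) J =
   l * q J - kos_htpy (fun k => GRing.scale (lam k) : {linear S -> S}) (kos_diff q) J.
  apply/eqP; rewrite -subr_eq opprK E /l mulr_suml; apply/eqP.
  by apply: eq_bigr => k _; rewrite -scalerAr -scalerAl.
by rewrite opprB addrCA; apply: ID => //; case: (hq J).
Qed.

End MultiplicationByForms.

(** * Koszul homology for the H-vector (1,4,4,4,4,1) *)

Section GorensteinH144441.
Variables (K : fieldType) (I : {mpoly K[4]} -> Prop).
Hypothesis charK : [pchar K] =i pred0.
Hypothesis homI : is_homog_ideal I.
Hypothesis nolinI : forall l : {mpoly K[4]}, l \is 1.-homog -> I l -> l = 0.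
Hypothesis gorI : quotient_artinian_gorenstein I.
Hypothesis HvecI : has_H_vector I [:: 1; 4; 4; 4; 4; 1]%N.
Local Notation S := {mpoly K[4]}.

Let I0 := ideal0 homI.
Let ID := @idealD _ _ _ homI.
Let IM := @idealM _ _ _ homI.
Let IN := @idealN _ _ _ homI.
Let IB := @idealB _ _ _ homI.
Let IZ := @idealZ _ _ _ homI.
Let Isum := @ideal_sum _ _ _ homI.
Let natK (k : nat) : (0 < k)%N -> k%:R != 0 :> K.
Proof. by move=> k0; have /pcharf0P -> := charK; rewrite -lt0n. Qed.

Let homX k d (p : S) : p \is d.-homog -> 'X_k * p \is d.+1.-homog.
Proof. by move=> hp; rewrite -[d.+1]add1n; apply: dhomogM => //; rewrite dhomogX /= mdeg1. Qed.

Lemma degree_ge6 d p : (6 <= d)%N -> p \is d.-homog -> I p.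
Proof.
move=> d6 hp; have [_ /(_ d)] := HvecI; rewrite nth_default // => -[e [_ _ /(_ p hp)[c]]].
by rewrite big_ord0 subr0.
Qed.

Lemma degree5_basis : exists2 s : S, s \is 5.-homog & ~ I s /\
  forall p, p \is 5.-homog -> exists c : K, I (p - c *: s).
Proof.
have [_ /(_ 5)] := HvecI; rewrite /= => -[e [he fe se]].
exists (e 0) => //; split.
  move=> es; have := fe (fun _ => 1); rewrite big_ord1 scale1r => /(_ es 0) /eqP.
  by rewrite oner_eq0.
by move=> p /se[c]; rewrite big_ord1; exists (c 0).
Qed.

(** The socle is one-dimensional and contains the nonzero space A_5, so p is congruent to a multiple
    of a form of degree 5; comparing parts of degree d leaves p in I. *)
Lemma socle_degree d p : (d <= 4)%N -> p \is d.-homog -> (forall k, I ('X_k * p)) -> I p.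
Proof.
move=> d4 hp sp; have [s hs [ns _]] := degree5_basis.
have [_ [e [_ _ se]]] := gorI.
have [c] := se p sp; rewrite big_ord1 => hc.
have [c'] : exists c' : 'I_1 -> K, I (s - \sum_k c' k *: e k).
  by apply: se => k; apply: (@degree_ge6 6) => //; apply: homX.
rewrite big_ord1 => hc'.
have c'0 : c' 0 != 0 by apply: contra_notN ns => /eqP c0; move: hc'; rewrite c0 scale0r subr0.
have h : I (c' 0 *: p - c 0 *: s).
  have := IB (IZ (c' 0) hc) (IZ (c 0) hc'); congr I.
  rewrite -!mul_mpolyC; ring.
have [_ /(_ _ d h)] := homI; rewrite pihomogB linearZ linearZ /= (pihomog_dE hp).
rewrite (pihomog_ne0 _ hs) ?scaler0 ?subr0; first exact: (ideal_scaleI homI).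
by rewrite neq_ltn ltnS d4 orbT.
Qed.

Lemma linear_form_annihilated m : m \is 1.-homog ->
  (forall a b c d : 'I_4, I ('X_a * ('X_b * ('X_c * ('X_d * m))))) -> I m.
Proof.
move=> hm h.
apply: (@socle_degree 1) => // d; apply: (@socle_degree 2); rewrite ?homX // => c.
apply: (@socle_degree 3); rewrite ?homX // => b.
by apply: (@socle_degree 4); rewrite ?homX // => a; apply: h.
Qed.

Definition ann_not_killed (y x : S) : Prop := exists m, [/\ m \is 1.-homog, I (x * m) & ~ I (y ^+ 4 * m)].

(* Five annihilators m_i of x + t_i y in the four-dimensional space A_1 are
   dependent; multiplying a relation by the other four x + t_i y leaves
   y^4 m_i = 0 for some i. *)
Lemma pencil_not_all_ann_not_killed (x y : S) (t : 'I_5 -> K) : injective t ->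
  exists i, ~ ann_not_killed y (x + t i *: y).
Proof.
move=> injt; apply: NNPP => /not_ex_not_all allbad.
have /fin_all_exists [m hm] : forall i, exists m, [/\ m \is 1.-homog, I ((x + t i *: y) * m) & ~ I (y ^+ 4 * m)].
  by move=> i; apply: allbad.
have [_ /(_ 1%N)] := HvecI; rewrite /= => -[e [he fe se]].
have /fin_all_exists [C hC] : forall i, exists c : 'I_4 -> K, I (m i - \sum_k c k *: e k).
  by move=> i; apply: se; case: (hm i).
pose CM := \matrix_(i, k) C i k.
have : ~~ row_free CM.
  by rewrite /row_free neq_ltn ltnS rank_leq_col.
rewrite -kermx_eq0 => /rowV0Pn[v /sub_kermxP vC /rV0Pn[i0 vi0]].
have hv : I (\sum_i v 0 i *: m i).
  apply: (ideal_eqmod homI (q := \sum_k (v *m CM) 0 k *: e k)).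
    apply: lincomb_mod => // i; move: (hC i); congr (I (_ - _)).
    by apply: eq_bigr => k _; rewrite mxE.
  by rewrite vC big1 // => k _; rewrite mxE scale0r.
pose r := [seq i <- enum 'I_5 | i != i0].
pose Pi := \prod_(i <- r) (x + t i *: y).
have h1 : I (Pi * (v 0 i0 *: m i0)).
  have := IM Pi hv; rewrite (bigD1 i0) //= mulrDr => h.
  rewrite -[X in I X](addrK (Pi * \sum_(i | i != i0) v 0 i *: m i)); apply: IB => //.
  rewrite mulr_sumr; apply: Isum => i ii0; rewrite -scalerAr; apply: IZ.
  have ir : i \in r by rewrite mem_filter ii0 mem_enum.
  rewrite /Pi (big_rem i) //= mulrAC mulrC; apply: IM; by case: (hm i).
have h2 : I (Pi * m i0) by move: h1; rewrite -scalerAr; apply: (ideal_scaleI homI).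
(* As x + t_i0 y kills m_i0, any other factor x + t_i y acts on m_i0 as (t_i - t_i0) y. *)
have key (s : seq 'I_5) : I (\prod_(i <- s) (x + t i *: y) * m i0
    - (\prod_(i <- s) (t i - t i0)) *: (y ^+ size s * m i0)).
  elim: s => [|i s IHs]; first by rewrite !big_nil expr0 scale1r subrr.
  rewrite !big_cons /= exprS.
  have [_ hx _] := hm i0.
  have := ID (IM (x + t i *: y) IHs) (IM ((\prod_(i <- s) (t i - t i0))%:MP * y ^+ size s) hx).
  congr I; rewrite -!mul_mpolyC !mpolyCM !mpolyCD mpolyCN; ring.
have := IB h2 (key r); rewrite opprB addrC subrK.
have -> : size r = 4.
  by rewrite /r -rem_filter ?enum_uniq // size_rem ?mem_enum // size_enum_ord.
have [_ _ nm] := hm i0 => h; apply: nm; apply: (ideal_scaleI homI) h.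
rewrite prodf_seq_neq0; apply/allP=> i; rewrite mem_filter => /andP[ii0 _] /=.
by rewrite subr_eq0 (inj_eq injt).
Qed.

(* Polarization: 24 x_a x_b x_c x_d is a signed sum of fourth powers of the
   partial sums of x_a + x_b + x_c + x_d. *)
Lemma fourth_powers_span (m : S) :
  (forall s : seq 'I_4, (size s <= 4)%N -> I ((\sum_(i <- s) 'X_i) ^+ 4 * m)) ->
  forall a b c d : 'I_4, I ('X_a * ('X_b * ('X_c * ('X_d * m)))).
Proof.
move=> h a b c d; apply: (ideal_scaleI homI (natK (isT : (0 < 24)%N))).
have P s : (size s <= 4)%N -> I ((\sum_(i <- s) 'X_i) ^+ 4 * m) by apply: h.
have := ID (IB (ID (P [:: a; b; c; d] isT)
  (ID (P [:: a; b] isT) (ID (P [:: a; c] isT) (ID (P [:: a; d] isT)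
  (ID (P [:: b; c] isT) (ID (P [:: b; d] isT) (P [:: c; d] isT)))))))
  (ID (P [:: a; b; c] isT) (ID (P [:: a; b; d] isT) (ID (P [:: a; c; d] isT) (P [:: b; c; d] isT)))))
  (IN (ID (P [:: a] isT) (ID (P [:: b] isT) (ID (P [:: c] isT) (P [:: d] isT))))).
rewrite !big_cons !big_nil !addr0; congr I; rewrite scaler_nat.
move: ('X_a) ('X_b) ('X_c) ('X_d) => xa xb xc xd; ring.
Qed.

Lemma lefschetz_element : exists lam : 'I_4 -> K,
  forall m, m \is 1.-homog -> I ((\sum_k lam k *: 'X_k) * m) -> I m.
Proof.
(* Multiplicities from 0 to 4 of the four variables cover every sum of at most four variables. *)
pose T := {ffun 'I_4 -> 'I_5}.
pose y (tau : T) : S := \sum_k (tau k)%:R *: 'X_k.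
(* Each direction has at most 4 exceptional values, and [avoidance] wants a grid side above 4 times
   the number of directions. *)
pose q := (4 * #|T|)%N.
(* Varying the coordinate tau of g moves [x g] along a pencil in the direction [y tau]. *)
pose x (g : {ffun T -> 'I_q.+1}) : S := \sum_tau (g tau)%:R *: y tau.
pose B (tau : T) (g : {ffun T -> 'I_q.+1}) : bool :=
  if excluded_middle_informative (ann_not_killed (y tau) (x g)) then true else false.
have BP tau g : reflect (ann_not_killed (y tau) (x g)) (B tau g).
  by rewrite /B; case: excluded_middle_informative => h; constructor.
have [tau g||g hg] := @avoidance T q 4 B; last first.
- exists (fun k => \sum_tau (g tau)%:R * (tau k)%:R) => m hm.
  have -> : \sum_k (\sum_tau (g tau)%:R * (tau k)%:R) *: 'X_k = x g.
    under eq_bigr do rewrite scaler_suml.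
    rewrite exchange_big; apply: eq_bigr => tau _ /=.
    by rewrite scaler_sumr; apply: eq_bigr => k _; rewrite scalerA.
  move=> xm; apply: linear_form_annihilated => //; apply: fourth_powers_span => s s4.
  pose tau : T := [ffun k => inord (count_mem k s)].
  have -> : \sum_(i <- s) 'X_i = y tau.
    rewrite /y [RHS](eq_bigr (fun k => \sum_(i <- s) ((i == k)%:R *: 'X_i))) => [|k _].
      rewrite [RHS]exchange_big /=; apply: eq_bigr => i _.
      rewrite [RHS](bigD1 i) //= eqxx scale1r big1 ?addr0 // => k; rewrite eq_sym => /negbTE ->.
      by rewrite scale0r.
    rewrite ffunE inordK; last by rewrite ltnS (leq_trans (count_size _ _)).
    rewrite -sum1_count natr_sum scaler_suml [LHS]big_mkcond; apply: eq_bigr => i _ /=.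
    by case: eqP => [->|_]; rewrite ?scale0r.
  by apply: NNPP => nI; have /BP[] := hg tau; exists m.
- by [].
(* Five exceptional values would be five exceptional members of one pencil; characteristic zero
   keeps the corresponding scalars distinct. *)
rewrite leqNgt; apply/negP=> c4; set A := [set t | _] in c4.
pose f (i : 'I_5) : 'I_q.+1 := enum_val (widen_ord c4 i).
have [|i] := @pencil_not_all_ann_not_killed (\sum_(s | s != tau) (g s)%:R *: y s) (y tau) (fun i => (f i : nat)%:R).
- move=> i j fij; have : f i = f j.
    apply/val_inj; wlog le : i j fij / (f i <= f j)%N.
      by move=> h; case: (leqP (f i) (f j)) => [|/ltnW] le; [apply: h | apply/esym/h].
    apply/eqP; rewrite eqn_leq le /= -subn_eq0 -(pcharf0P K).1 //.
    by rewrite natrB // fij subrr.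
  by move/enum_val_inj/(congr1 val) => /= ij; apply/val_inj.
apply; have := enum_valP (widen_ord c4 i); rewrite inE => /BP.
rewrite /x (bigD1 tau) //= ffunE eqxx addrC (eq_bigr (fun s => (g s)%:R *: y s)) //.
by move=> s /negbTE st; rewrite ffunE st.
Qed.

(** Degree a uses surjectivity of l from A_(a-1) and injectivity on A_a, so a = 2, 3 is exactly what
    bijectivity along A_1, ..., A_4 covers. *)
Lemma acyclic_middle i : koszul_acyclic I i 2 /\ koszul_acyclic I i 3.
Proof.
have [lam inj1] := lefschetz_element; set l := \sum_k _ in inj1.
have hl : l \is 1.-homog.
  by apply: rpred_sum => k _; apply: rpredZ; rewrite dhomogX /= mdeg1.
have [_ dims] := HvecI.
have surj1 := mul_inj_surj homI hl (dims 1%N) (dims 2) inj1.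
have surj2 := surj_succ charK homI surj1.
have surj3 := surj_succ charK homI surj2.
have inj2 := mul_surj_inj homI hl (dims 2) (dims 3) surj2.
have inj3 := mul_surj_inj homI hl (dims 3) (dims 4) surj3.
by split; apply: (koszul_acyclic_bij homI (lam := lam)).
Qed.

(** A cycle with constant coefficients has linear forms in I, hence zero, as its differential, and
    [p J] is up to sign the coefficient of x_k in the component J minus k. *)
Lemma acyclic_degree0 i : (0 < i)%N -> koszul_acyclic I i 0.
Proof.
move=> i0 p hp pi cp.
have pC J : p J = ((p J)@_0%MM)%:MP by apply: zhomog_const; apply/zhomog_dhomog.
suff p0 J : p J = 0.
  by exists (fun _ => 0) => J; rewrite p0 /kos_diff big1 ?subr0 // => k _; rewrite !mulr0.
have [Ji|/pi//] := eqVneq #|J| i.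
have [k kJ] : exists k, k \in J by apply/set0Pn; rewrite -card_gt0 Ji.
have E : kos_diff p (J :\ k) = \sum_(l | l \notin J :\ k)
    ((-1) ^+ kos_sign l (J :\ k) * (p (l |: (J :\ k)))@_0%MM) *: 'X_l.
  apply: eq_bigr => l _; rewrite {1}pC -!mul_mpolyC mpolyCM rmorph_sign; ring.
have : kos_diff p (J :\ k) = 0.
  apply: nolinI (cp _); rewrite E; apply: rpred_sum => l _; apply: rpredZ.
  by rewrite dhomogX /= mdeg1.
rewrite E => /(congr1 (mcoeff U_(k)%MM)); rewrite raddf_sum mcoeff0 (bigD1 k) ?setD11 //=.
rewrite big1 ?addr0 => [|l /andP[_ /negbTE lk]]; last by rewrite mcoeffZ mcoeffXU lk mulr0.
rewrite mcoeffZ mcoeffXU eqxx mulr1 setD1K // => /eqP; rewrite mulf_eq0 signr_eq0 /= => /eqP c0.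
by rewrite pC c0 mpolyC0.
Qed.

(** H_0 is A modulo the variables, and a form of positive degree lies in the ideal they generate. *)
Lemma acyclic_hd0 d : koszul_acyclic I 0 d.+1.
Proof.
move=> p hp p0 _; have [u hu pE] := homog_split charK (hp set0).
exists (fun J => \sum_k u k *+ (J == [set k])) => J.
have [->|J0] := eqVneq J set0; last first.
  rewrite p0 ?cards_eq0 // sub0r; apply: IN; apply: Isum => k kJ; do 2!apply: IM.
  rewrite big1 // => l _; case: eqP => // /(congr1 (fun A : {set 'I_4} => #|A|)).
  rewrite cards1 cardsU1 kJ => -[/eqP]; rewrite cards_eq0; by rewrite (negbTE J0).
rewrite /kos_diff pE [X in _ - X](eq_bigl xpredT) => [|k]; last by rewrite inE.
rewrite -sumrB; apply: Isum => k _.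
rewrite (_ : kos_sign k set0 = 0%N); last by apply: eq_card0 => l; rewrite !inE.
rewrite expr0 mul1r setU0 (bigD1 k) //= eqxx big1 ?addr0 ?subrr // => l lk.
by case: eqP => // /set1_inj kl; rewrite kl eqxx in lk.
Qed.

(** H_4 is the socle of A, sitting on the full set of indices. *)
Lemma acyclic_hd4 d : (d <= 4)%N -> koszul_acyclic I 4 d.
Proof.
move=> d4 p hp p4 cp; exists (fun _ => 0) => J.
rewrite /kos_diff big1 ?subr0 => [|k _]; last by rewrite !mulr0.
have [J4|/p4->//] := eqVneq #|J| 4.
have JT : J = setT by apply/eqP; rewrite eqEcard subsetT cardsT card_ord J4.
rewrite {J J4}JT; apply: socle_degree (hp _) _ => // k.
have := cp (setT :\ k); rewrite /kos_diff (bigD1 k) ?setD11 //= setD1K ?inE //.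
rewrite big1 ?addr0 => [h|l]; last by rewrite !inE andbT negbK => /andP[->].
by have := IM ((-1) ^+ kos_sign k ([set: 'I_4] :\ k)) h; rewrite signMsq.
Qed.

(** The pairing of A_1 and A_4 into A_5 is perfect: no nonzero element of A_4 is in the socle, and
    both spaces have dimension 4. Here u is s times the dual of x_k. *)
Lemma dual_degree4 k s : s \is 5.-homog ->
  exists2 u : S, u \is 4.-homog & forall l, I ('X_l * u - s *+ (l == k)).
Proof.
move=> hs; have [s0 hs0 [_ ss]] := degree5_basis.
have [_ /(_ 4)] := HvecI; rewrite /= => -[e [he fe se]].
have /fin_all_exists [E hE] : forall kl : 'I_4 * 'I_4, exists c : K, I ('X_(kl.2) * e kl.1 - c *: s0).
  by move=> kl; apply: ss; apply: homX.
pose EM := \matrix_(a, l) E (a, l).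
have mulE (u : 'rV[K]_4) l : I ('X_l * (\sum_a u 0 a *: e a) - (u *m EM) 0 l *: s0).
  rewrite mxE scaler_suml mulr_sumr -sumrB; apply: Isum => a _.
  rewrite mxE -scalerAr -scalerA -scalerBr; apply: IZ; exact: (hE (a, l)).
have Efull : row_full EM.
  rewrite row_full_unit -row_free_unit -kermx_eq0; apply/rowV0P=> v /sub_kermxP vE.
  have hv : I (\sum_a v 0 a *: e a).
    apply: (@socle_degree 4) => // [|l]; first exact: homog_lincomb.
    by have := mulE v l; rewrite vE mxE scale0r subr0.
  by apply/rowP=> a; rewrite (fe _ hv) mxE.
have [c hc] := ss s hs.
pose u : 'rV[K]_4 := c *: delta_mx 0 k *m pinvmx EM.
exists (\sum_a u 0 a *: e a) => [|l]; first exact: homog_lincomb.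
have := mulE u l; rewrite mulmxKpV ?submx_full // !mxE eqxx /=.
case: (l == k); last by rewrite mulr0 scale0r mulr0n.
by rewrite mulr1 mulr1n => h; have := IB h hc; congr I; ring.
Qed.

(** For #|J| = i at most 3 some index [kap J] lies outside J. By duality [u J] in A_4 gives [p J]
    when multiplied by that variable and 0 by the others, so placing it on [kap J |: J] has the
    single boundary term [p J] on J. *)
Lemma acyclic_degree5 i : (i <= 3)%N -> koszul_acyclic I i 5.
Proof.
move=> i3 p hp pi _.
have /fin_all_exists [kap hkap] : forall J : {set 'I_4}, exists k, (#|J| == i) ==> (k \notin J).
  move=> J; have [Ji|_] := eqVneq #|J| i; last by exists ord0.
  have : ~: J != set0 by rewrite -card_gt0 cardsCs setCK card_ord Ji; lia.
  by case/set0Pn=> k; rewrite inE; exists k.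
have /fin_all_exists [u hu] : forall J : {set 'I_4}, exists u : S, forall l, I ('X_l * u - p J *+ (l == kap J)).
  by move=> J; have [u _] := dual_degree4 (kap J) (hp J); exists u.
pose q J1 : S := \sum_(J : {set 'I_4} | #|J| == i)
  ((-1) ^+ kos_sign (kap J) J * u J) *+ (J1 == kap J |: J).
exists q => J1.
have -> : kos_diff q J1 = \sum_(J : {set 'I_4} | #|J| == i)
   \sum_(k | (k \notin J1) && (k |: J1 == kap J |: J))
     (-1) ^+ kos_sign k J1 * ((-1) ^+ kos_sign (kap J) J * ('X_k * u J)).
  rewrite /kos_diff /q; under eq_bigr do rewrite !mulr_sumr.
  rewrite exchange_big; apply: eq_bigr => J Ji /=.
  rewrite big_mkcondr; apply: eq_bigr => k kJ; case: eqP => _; last by rewrite mulr0n !mulr0.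
  by rewrite mulr1n ['X_k * _]mulrCA.
have -> : p J1 = \sum_(J : {set 'I_4} | #|J| == i) p J *+ (J == J1).
  have [Ji|Ji] := eqVneq #|J1| i.
    rewrite (bigD1 J1) ?Ji ?eqxx //= big1 ?addr0 // => J /andP[_ /negbTE ->] //.
  rewrite pi // big1 // => J /eqP Ji'; case: eqP => // JJ; by rewrite -JJ Ji' eqxx in Ji.
rewrite -sumrB; apply: Isum => J Ji; have := hkap J; rewrite Ji /= => kJ.
have [JE|JJ1] := eqVneq J J1.
  rewrite -{J1}JE (big_pred1 (kap J)) => [|k /=].
    by rewrite signMsq mulr1n -opprB; apply: IN; have := hu J (kap J); rewrite eqxx mulr1n.
  apply/idP/idP=> [/andP[kJ1 /eqP/setP/(_ k)]|/eqP ->]; last by rewrite kJ eqxx.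
  by rewrite !inE eqxx (negbTE kJ1) !orbF => /esym.
rewrite mulr0n sub0r; apply: IN; apply: Isum => k /andP[kJ1 /eqP E]; do 2!apply: IM.
have := hu J k; case: eqP => [kk|_]; last by rewrite mulr0n subr0.
by case/eqP: JJ1; rewrite -(setU1K kJ) -E -kk setU1K.
Qed.

End GorensteinH144441.

(** * A homogeneous basis of A and the evaluation of the Betti table *)

Lemma graded_basis n (K : fieldType) (I : {mpoly K[n]} -> Prop) (h : seq nat) :
  is_homog_ideal I -> has_H_vector I h ->
  exists (Y : finType) (e : Y -> {mpoly K[n]}) (dgY : Y -> nat),
   [/\ (forall y, e y \is (dgY y).-homog),
       (forall c : Y -> K, I (\sum_y c y *: e y) -> forall y, c y = 0),
       (forall p, exists c : Y -> K, I (p - \sum_y c y *: e y)) &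
       forall d, #|[set y | dgY y == d]| = nth 0%N h d].
Proof.
move=> homI [_ dims].
have [[I0 addI _] pI] := homI.
have ID p q : I p -> I q -> I (p + q) by apply: addI.
have dims' (d : 'I_(size h)) : exists e : 'I_(nth 0%N h d) -> {mpoly K[n]},
   [/\ (forall k, e k \is d.-homog),
    (forall c : 'I_(nth 0%N h d) -> K, I (\sum_k c k *: e k) -> forall k, c k = 0) &
    (forall p, p \is d.-homog -> exists c : 'I_(nth 0%N h d) -> K, I (p - \sum_k c k *: e k))].
  exact: dims.
have [e he] := fin_all_exists dims'.
pose Y : finType := {d : 'I_(size h) & 'I_(nth 0%N h d)}.
pose ey (y : Y) := e (tag y) (tagged y).
pose dgY (y : Y) : nat := tag y.
have sumY (c : Y -> K) : \sum_y c y *: ey y =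
    \sum_d \sum_k c (Tagged (fun d : 'I_(size h) => 'I_(nth 0%N h d)) k) *: e d k.
  by rewrite sig_big_dep /=; apply: eq_bigr => -[d k] _.
have ehom d k : e d k \is d.-homog by case: (he d).
exists Y, ey, dgY; split=> [y|c hc y|p|d].
- exact: ehom.
- have := pI _ (tag y) hc; rewrite sumY linear_sum (bigD1 (tag y)) //= [X in _ + X]big1 ?addr0.
    rewrite (pihomog_dE (homog_lincomb _ (ehom _))) => hy.
    by have [_ fe _] := he (tag y); have := fe _ hy (tagged y); rewrite taggedK.
  move=> d dy; rewrite (pihomog_ne0 _ (homog_lincomb _ (ehom d))) //.
- have hd (d : 'I_(size h)) : exists c : 'I_(nth 0%N h d) -> K,
      I (pihomog mdeg d p - \sum_k c k *: e d k).
    by have [_ _ se] := he d; apply: se; apply: pihomogP.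
  have [c hc] := fin_all_exists hd.
  exists (fun y => c (tag y) (tagged y)); rewrite sumY /=.
  (* The bound is at least [size h], so the decomposition can be narrowed to the degrees below
     [size h]; the higher parts lie in I. *)
  have mp : (mmeasure mdeg p <= maxn (msize p) (size h))%N by apply: leq_maxl.
  rewrite {1}(pihomog_partitionE mp) (bigID (fun d : 'I__ => d < size h)%N) /= addrAC.
  apply: ID; last first.
    elim/big_ind: _ => // d; rewrite -leqNgt => sd.
    have [e' [_ _ /(_ (pihomog mdeg d p))]] := dims d; rewrite (pihomogP _ _ _) => /(_ isT) [c'].
    by rewrite big1 ?subr0 // => -[k kos_diff]; exfalso; move: kos_diff; rewrite nth_default.
  rewrite (big_ord_narrow (leq_maxr _ _)) -sumrB; elim/big_ind: _ => // d _; exact: hc.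
have [dh|dh] := ltnP d (size h); last first.
  rewrite nth_default //; apply: eq_card0 => y; rewrite !inE /dgY.
  by apply: ltn_eqF; apply: leq_trans dh.
rewrite -[RHS]card_ord -[RHS](card_imset _ (f := fun k => Tagged (fun d : 'I_(size h) => 'I_(nth 0%N h d)) (i := Ordinal dh) k)); last first.
  by move=> k k' /eqP; rewrite eq_Tagged => /eqP.
apply: eq_card => -[d' k]; rewrite inE /dgY /=; apply/eqP/imsetP => [dd|[k' _ /(congr1 (@tag _ _)) /= -> //]].
have dE : d' = Ordinal dh by apply: val_inj.
by subst d'; exists k.
Qed.

Theorem theorem3p4 (K : fieldType) (charK : [pchar K] =i pred0)
    (I : {mpoly K[4]} -> Prop)
    (homI : is_homog_ideal I)
    (nolinI : forall l : {mpoly K[4]}, l \is 1.-homog -> I l -> l = 0)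
    (gorI : quotient_artinian_gorenstein I)
    (HvecI : has_H_vector I [:: 1; 4; 4; 4; 4; 1]%N) :
  has_graded_betti I
    (betti_table
      [:: (0%N, 0%Z, 1%N); (1%N, 2%Z, 6%N); (2%N, 3%Z, 8%N); (3%N, 4%Z, 3%N);
          (1%N, 5%Z, 3%N); (2%N, 6%Z, 8%N); (3%N, 7%Z, 6%N); (4%N, 9%Z, 1%N)]).
Proof.
have [Y [e [dgY [e_hom e_free e_span cardY]]]] := graded_basis homI HvecI.
have [rho rho0 [exF betti]] := koszul_betti charK homI e_hom e_free e_span.
split=> // F mF i j.
have [E V] := betti F mF.
have V2 i' := V i' 2 (proj1 (acyclic_middle charK homI gorI HvecI i')).
have V3 i' := V i' 3 (proj2 (acyclic_middle charK homI gorI HvecI i')).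
have V0 i' : gf_betti F i'.+1 (i'.+1 + 0)%N%:Z = 0%N by apply/V/acyclic_degree0.
have V5 i' : (i' <= 3)%N -> gf_betti F i' (i' + 5)%N%:Z = 0%N.
  by move=> i3; apply/V/(acyclic_degree5 homI gorI HvecI).
have Vh0 d : gf_betti F 0 d.+1%:Z = 0%N by apply: (V 0%N d.+1); apply: acyclic_hd0.
have Vh4 d : (d <= 4)%N -> gf_betti F 4 (4 + d)%N%:Z = 0%N.
  by move=> d4; apply/V/(acyclic_hd4 homI gorI HvecI).
(* nn i' k and vv i' k: the dimension of the Koszul chains of bidegree (i', k), and
   whether the homology there is known to vanish. *)
pose nn i' k := if (k < i')%N then 0%N else
  (nth 0 [:: 1; 4; 6; 4; 1] i' * nth 0 [:: 1; 4; 4; 4; 4; 1] (k - i'))%N.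
have N i' (k : nat) : (gf_betti F i' k%:Z + rho i'.+1 k%:Z + rho i' k%:Z)%N = nn i' k.
  rewrite /nn E; case: ltnP => ki.
    by rewrite card_koszul_basis0 // => a [ka]; move: ki; rewrite ka ltnNge leq_addr.
  rewrite -{1}(subnKC ki) card_koszul_basis cardY; congr (_ * _)%N.
  by case: i' {ki} => [|[|[|[|[|i']]]]] //; rewrite nth_default.
pose vv i' k := (i' <= k)%N && [|| (k - i' == 2)%N, (k - i' == 3)%N, (k == i') && (0 < i')%N,
   (k - i' == 5)%N && (i' <= 3)%N, (i' == 0)%N && (0 < k)%N | (i' == 4)%N && (k - i' <= 4)%N].
have W i' (k : nat) : (if vv i' k then gf_betti F i' k%:Z else 0%N) = 0%N.
  rewrite /vv; case: ifP => // /andP[ik]; rewrite -(subnKC ik) addKn.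
  case/or4P=> [/eqP->|/eqP->||/orP[|/orP[]]] //.
  - case/andP=> /eqP ki i0; rewrite (_ : k - i' = 0)%N; last by lia.
    by case: i' i0 {ik ki}.
  - by case/andP=> /eqP-> /V5.
  - by case/andP=> /eqP->; rewrite add0n; case: (k - 0)%N.
  - by case/andP=> /eqP-> /Vh4.
case: j => [k|k]; last first.
  have : gf_betti F i (Negz k) = 0%N by move: (E i (Negz k)); rewrite card_koszul_basis0 //; lia.
  by move=> ->; rewrite /betti_table unlock /= !xpair_eqE !andbF.
have [i5|i5] := leqP 5 i.
  have : gf_betti F i k%:Z = 0%N.
    by move: (N i k); rewrite /nn nth_default // mul0n; case: ifP => _; lia.
  by move=> ->; case: i i5 => [|[|[|[|[|i]]]]] // _; rewrite /betti_table unlock.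
(* With i at most 4 and A zero above degree 5, there are no chains beyond 9 = 4 + 5. *)
have [k10|k10] := leqP 10 k.
  have : gf_betti F i k%:Z = 0%N.
    by move: (N i k); rewrite /nn [nth _ _ (k - i)]nth_default /= ?muln0; [case: ifP => _; lia | lia].
  move=> ->; case: k k10 => [|[|[|[|[|[|[|[|[|[|k]]]]]]]]]] // _.
  by case: i i5 => [|[|[|[|[|i]]]]] // _; rewrite /betti_table unlock.
(* In each remaining strand all but at most one Betti number is known to vanish, and [rho] is 0 at
   both ends ([N 5] gives [rho 5 k = 0]), so the rank equations determine the last one. *)
move: (rho0 k) (N 0%N k) (N 1%N k) (N 2%N k) (N 3%N k) (N 4%N k) (N 5%N k)
  (W 0%N k) (W 1%N k) (W 2%N k) (W 3%N k) (W 4%N k).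
case: k k10 => [|[|[|[|[|[|[|[|[|[|k]]]]]]]]]] // _; rewrite /nn /vv /=;
  case: i i5 => [|[|[|[|[|i]]]]] // _; rewrite /betti_table unlock /=; lia.
Qed.
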